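(* Let $n,k,l\geq 1$ be integers, where $n$ is odd. Then the group $F^{k/l}(n)$ is not isomorphic to the fundamental group of an orientable hyperbolic 3-orbifold (in particular, of an orientable hyperbolic 3-manifold) of finite volume.
   Context: For integers $n,k,l\geq 1$, the Fractional Fibonacci group is $$F^{k/l}(n)=\langle x_0,\ldots,x_{n-1}\mid x_i^l x_{i+1}^k=x_{i+2}^l\ (0\leq i<n)\rangle,$$ with subscripts taken modulo $n$. No coprimality of $k,l$ is assumed. An orientable hyperbolic 3-orbifold of finite volume is a quotient $\mathbb{H}^3/\Gamma$, where $\Gamma$ is a discrete subgroup of finite covolume of $PSL(2,\mathbb{C})$ (the group of orientation preserving isometries of hyperbolic 3-space $\mathbb{H}^3$); its (orbifold) fundamental group is $\Gamma$. *)

(* Defs.v *)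
From HB Require Import structures.
From mathcomp Require Import all_boot all_order all_algebra.
From mathcomp Require Import all_classical all_reals all_analysis.
From mathcomp Require Import complex.

Set Implicit Arguments.
Unset Strict Implicit.
Unset Printing Implicit Defensive.

Import Order.TTheory GRing.Theory Num.Theory.
Import numFieldNormedType.Exports.

Local Open Scope classical_set_scope.
Local Open Scope group_scope.

Definition isomorphic (G H : groupType) : Prop :=
  exists f : {multiplicative G -> H}, bijective f.

Definition subgroup (G : groupType) (S : groupClosed G) : Type :=
  {x : G | x \in S}.

Section Subgroup.
Variables (G : groupType) (S : groupClosed G).

Lemma groupClosed_closed : group_closed S.
Proof.
split=> [|x y Sx Sy]; first exact: gpred1.
by apply: gpredM => //; exact: gpredVr.
Qed.

HB.instance Definition _ := [isSub of subgroup S for @sval G (fun x => x \in S)].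
HB.instance Definition _ := [Choice of subgroup S by <:].
HB.instance Definition _ :=
  SubChoice_isSubGroup.Build G [in S] (subgroup S) groupClosed_closed.
End Subgroup.

(* The letter [(x, false)] is the generator [x], [(x, true)] is its inverse. *)
Definition word (X : Type) : Type := seq (X * bool).

Definition flip_letter (X : Type) (a : X * bool) : X * bool := (a.1, ~~ a.2).

Definition word_inv (X : Type) (u : word X) : word X :=
  rev (map (@flip_letter X) u).

Definition word_pow (X : Type) (x : X) (m : nat) : word X :=
  nseq m (x, false).

Section Presentation.
Variables (X : choiceType) (rels : word X -> word X -> Prop).

(* Equality of words in the group < X | u = v whenever [rels u v] >. *)
Inductive pres_eq : word X -> word X -> Prop :=
| pres_refl u : pres_eq u u
| pres_sym u v : pres_eq u v -> pres_eq v u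
| pres_trans u v w : pres_eq u v -> pres_eq v w -> pres_eq u w
| pres_cat u u' v v' :
    pres_eq u u' -> pres_eq v v' -> pres_eq (u ++ v) (u' ++ v')
| pres_cancel a : pres_eq [:: a; flip_letter a] [::]
| pres_rel u v : rels u v -> pres_eq u v.

Definition pres_eqb (u v : word X) : bool := `[< pres_eq u v >].

Lemma pres_eqb_equiv : equiv_class_of pres_eqb.
Proof.
split=> [u|u v|v u w]; first by apply/asboolP; exact: pres_refl.
- by apply/asboolP/asboolP; exact: pres_sym.
- by move=> /asboolP uv /asboolP vw; apply/asboolP; exact: pres_trans uv vw.
Qed.

Canonical pres_eqb_rel := EquivRelPack pres_eqb_equiv.

Definition presented : Type := {eq_quot pres_eqb_rel}%qT.

HB.instance Definition _ := Choice.on presented.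
HB.instance Definition _ := EqQuotient.on presented.

Local Open Scope quotient_scope.

Lemma presented_eqP (u v : word X) :
  reflect (pres_eq u v) (\pi_presented u == \pi_presented v).
Proof. by rewrite eqquotE; exact: asboolP. Qed.

Lemma pres_repr (u : word X) : pres_eq (repr (\pi_presented u)) u.
Proof. by apply/presented_eqP; rewrite reprK. Qed.

Definition pres_one : presented := \pi_presented [::].
Definition pres_mul (x y : presented) : presented :=
  \pi_presented ((repr x : word X) ++ repr y).
Definition pres_inv (x : presented) : presented :=
  \pi_presented (word_inv (repr x)).

Lemma flip_letterK : involutive (@flip_letter X).
Proof. by case=> x b; rewrite /flip_letter /= negbK. Qed.

Lemma word_invK : involutive (@word_inv X).
Proof.
by move=> u; rewrite /word_inv map_rev revK mapK //; exact: flip_letterK.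
Qed.

Lemma pres_mulV_word (u : word X) : pres_eq (u ++ word_inv u) [::].
Proof.
elim: u => [|a u IHu]; first exact: pres_refl.
rewrite /word_inv map_cons rev_cons -cats1 -/(word_inv u) -cat1s.
have -> : ([:: a] ++ u) ++ word_inv u ++ [:: flip_letter a] =
          [:: a] ++ (u ++ word_inv u) ++ [:: flip_letter a] by rewrite !catA.
apply: pres_trans (pres_cancel a); apply: (@pres_cat [:: a] [:: a]).
  exact: pres_refl.
by apply: (@pres_cat _ [::] _ [:: flip_letter a]) IHu _; exact: pres_refl.
Qed.

Lemma pi_pres_mul (u v : word X) :
  pres_mul (\pi_presented u) (\pi_presented v) = \pi_presented (u ++ v).
Proof. by apply/eqP/presented_eqP; apply: pres_cat; exact: pres_repr. Qed.

Lemma pres_mulA : associative pres_mul.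
Proof.
elim/quotW=> x; elim/quotW=> y; elim/quotW=> z.
by rewrite [pres_mul (\pi y) _]pi_pres_mul [pres_mul (\pi x) (\pi y)]pi_pres_mul 2!pi_pres_mul catA.
Qed.

Lemma pres_mul1 : left_id pres_one pres_mul.
Proof. by move=> x; rewrite -[x]reprK pi_pres_mul. Qed.

Lemma pres_mulr1 : right_id pres_one pres_mul.
Proof. by move=> x; rewrite -[x]reprK pi_pres_mul cats0. Qed.

Lemma pres_mulV : right_inverse pres_one pres_inv pres_mul.
Proof.
move=> x; rewrite -[x in pres_mul x _]reprK pi_pres_mul.
by apply/eqP/presented_eqP; exact: pres_mulV_word.
Qed.

Lemma pres_Vmul : left_inverse pres_one pres_inv pres_mul.
Proof.
move=> x; rewrite -[x in pres_mul _ x]reprK pi_pres_mul.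
apply/eqP/presented_eqP; rewrite -[X in _ ++ X]word_invK.
exact: pres_mulV_word.
Qed.

HB.instance Definition _ := isGroup.Build presented
  pres_mulA pres_mul1 pres_mulr1 pres_Vmul pres_mulV.

Definition pres_gen (x : X) : presented := \pi_presented [:: (x, false)].

Lemma pi_word_pow (x : X) m :
  \pi_presented (word_pow x m) = pres_gen x ^+ m.
Proof.
elim: m => [|m IHm]; first by rewrite expg0.
by rewrite expgS -IHm; exact/esym/(pi_pres_mul [:: (x, false)]).
Qed.

Definition word_eval (H : groupType) (f : X -> H) (u : word X) : H :=
  foldr (fun a h => (if a.2 then (f a.1)^-1 else f a.1) * h) 1 u.

Lemma word_eval_cat (H : groupType) (f : X -> H) u v :
  word_eval f (u ++ v) = word_eval f u * word_eval f v.
Proof. by elim: u => [|a u IHu] /=; rewrite ?mul1g // IHu mulgA. Qed.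

Lemma pres_eq_eval (H : groupType) (f : X -> H) :
  (forall u v, rels u v -> word_eval f u = word_eval f v) ->
  forall u v, pres_eq u v -> word_eval f u = word_eval f v.
Proof.
move=> rf u v; elim=> //= {u v}.
- by move=> u v w _ -> _ ->.
- by move=> u u' v v' _ e _ e'; rewrite !word_eval_cat e e'.
- by case=> x [] /=; rewrite mulg1 ?mulVg ?mulgV.
Qed.

Definition pres_lift (H : groupType) (f : X -> H) (x : presented) : H :=
  word_eval f (repr x).

Lemma pres_lift_pi (H : groupType) (f : X -> H) :
  (forall u v, rels u v -> word_eval f u = word_eval f v) ->
  forall u, pres_lift f (\pi_presented u) = word_eval f u.
Proof. by move=> rf u; apply: pres_eq_eval => //; exact: pres_repr. Qed.

End Presentation.

(* [ordS i] is the successor of [i] modulo [n]. *)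
Definition frac_fib_rel (n k l : nat) (u v : word 'I_n) : Prop :=
  exists i : 'I_n,
    u = word_pow i l ++ word_pow (ordS i) k /\ v = word_pow (ordS (ordS i)) l.

Definition frac_fib (n k l : nat) : Type := presented (@frac_fib_rel n k l).

HB.instance Definition _ n k l := Group.on (frac_fib n k l).

Lemma frac_fib_relation n k l (i : 'I_n) (x := pres_gen (@frac_fib_rel n k l)) :
  x i ^+ l * x (ordS i) ^+ k = x (ordS (ordS i)) ^+ l.
Proof.
rewrite /x -!pi_word_pow [LHS]pi_pres_mul.
by apply/eqP/presented_eqP/pres_rel; exists i.
Qed.

Local Open Scope ring_scope.
Local Open Scope complex_scope.

Section SL2.
Variable R : realType.

Record SL2 := MkSL2 { slval :> 'M[R[i]]_2; _ : \det slval == 1 }.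

HB.instance Definition _ := [isSub for slval].
HB.instance Definition _ := [Choice of SL2 by <:].

Lemma sl_det (M : SL2) : \det M = 1. Proof. by case: M => M /= /eqP. Qed.

Lemma sl_unit (M : SL2) : (M : 'M[R[i]]_2) \in unitmx.
Proof. by rewrite unitmxE sl_det unitr1. Qed.

Lemma sl_one_subproof : \det (1%:M : 'M[R[i]]_2) == 1.
Proof. by rewrite det1. Qed.
Lemma sl_mul_subproof (M N : SL2) : \det ((M : 'M[R[i]]_2) *m N) == 1.
Proof. by rewrite det_mulmx !sl_det mulr1. Qed.
Lemma sl_inv_subproof (M : SL2) : \det (invmx M) == 1.
Proof. by rewrite det_inv sl_det invr1. Qed.
Lemma sl_opp_subproof (M : SL2) : \det (- (M : 'M[R[i]]_2)) == 1.
Proof. by rewrite -scaleN1r detZ sl_det sqrrN expr1n mulr1. Qed.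

Definition sl_one := MkSL2 sl_one_subproof.
Definition sl_mul (M N : SL2) := MkSL2 (sl_mul_subproof M N).
Definition sl_inv (M : SL2) := MkSL2 (sl_inv_subproof M).
Definition sl_opp (M : SL2) := MkSL2 (sl_opp_subproof M).

Lemma sl_mulA : associative sl_mul.
Proof. by move=> M N P; apply/val_inj; rewrite /= mulmxA. Qed.
Lemma sl_mul1 : left_id sl_one sl_mul.
Proof. by move=> M; apply/val_inj; rewrite /= mul1mx. Qed.
Lemma sl_mulr1 : right_id sl_one sl_mul.
Proof. by move=> M; apply/val_inj; rewrite /= mulmx1. Qed.
Lemma sl_Vmul : left_inverse sl_one sl_inv sl_mul.
Proof. by move=> M; apply/val_inj; rewrite /= mulVmx ?sl_unit. Qed.
Lemma sl_mulV : right_inverse sl_one sl_inv sl_mul.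
Proof. by move=> M; apply/val_inj; rewrite /= mulmxV ?sl_unit. Qed.

HB.instance Definition _ :=
  isGroup.Build SL2 sl_mulA sl_mul1 sl_mulr1 sl_Vmul sl_mulV.

(* The topology induced by the one of C^4; the alias [R[i]^o] carries the
   topology given by the modulus. *)
Definition sl_entries (M : SL2) : 'M[R[i]^o]_2 := slval M.
HB.instance Definition _ :=
  Topological.copy SL2 (initial_topology sl_entries).

Definition sl_pm (M N : SL2) : bool := (M == N) || (M == sl_opp N).

Lemma sl_oppK : involutive sl_opp.
Proof. by move=> M; apply/val_inj; rewrite /= opprK. Qed.

Lemma sl_pm_equiv : equiv_class_of sl_pm.
Proof.
split=> [M|M N|N M P]; first by rewrite /sl_pm eqxx.
- by rewrite /sl_pm eq_sym; congr (_ || _); rewrite eq_sym (can2_eq sl_oppK sl_oppK).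
- rewrite /sl_pm => /orP[]/eqP-> // /orP[]/eqP->; rewrite ?sl_oppK eqxx ?orbT //.
Qed.

Canonical sl_pm_rel := EquivRelPack sl_pm_equiv.

Definition PSL2 : Type := quotient_topology {eq_quot sl_pm_rel}%qT.

HB.instance Definition _ := Choice.on PSL2.
HB.instance Definition _ := Topological.on PSL2.
HB.instance Definition _ := Quotient.on PSL2.

Local Open Scope quotient_scope.

Lemma PSL2_eqP (M N : SL2) : reflect (M = N \/ M = sl_opp N)
  (\pi_PSL2 M == \pi_PSL2 N).
Proof.
have E := @eqquotP _ _ {eq_quot sl_pm_rel} M N.
apply: (iffP eqP) => [/E /orP[]/eqP|]; [by left | by right |].
by move=> MN; apply/E/orP; case: MN => ->; rewrite eqxx; [left | right].
Qed.

Lemma repr_pi_PSL2 (M : SL2) :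
  repr (\pi_PSL2 M) = M \/ repr (\pi_PSL2 M) = sl_opp M.
Proof. by apply/PSL2_eqP; rewrite reprK. Qed.

Definition psl_one : PSL2 := \pi_PSL2 sl_one.
Definition psl_mul (g h : PSL2) : PSL2 := \pi_PSL2 (sl_mul (repr g) (repr h)).
Definition psl_inv (g : PSL2) : PSL2 := \pi_PSL2 (sl_inv (repr g)).

Lemma pi_psl_mul (M N : SL2) :
  psl_mul (\pi_PSL2 M) (\pi_PSL2 N) = \pi_PSL2 (sl_mul M N).
Proof.
apply/eqP/PSL2_eqP.
have [->|->] := repr_pi_PSL2 M; have [->|->] := repr_pi_PSL2 N; first by left.
- by right; apply/val_inj; rewrite /= mulmxN.
- by right; apply/val_inj; rewrite /= mulNmx.
- by left; apply/val_inj; rewrite /= mulNmx mulmxN opprK.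
Qed.

Lemma psl_mulA : associative psl_mul.
Proof.
elim/quotW=> x; elim/quotW=> y; elim/quotW=> z.
by rewrite [psl_mul (\pi y) _]pi_psl_mul [psl_mul (\pi x) (\pi y)]pi_psl_mul 2!pi_psl_mul sl_mulA.
Qed.
Lemma psl_mul1 : left_id psl_one psl_mul.
Proof. by move=> x; rewrite -[x]reprK pi_psl_mul sl_mul1. Qed.
Lemma psl_mulr1 : right_id psl_one psl_mul.
Proof. by move=> x; rewrite -[x]reprK pi_psl_mul sl_mulr1. Qed.
Lemma psl_Vmul : left_inverse psl_one psl_inv psl_mul.
Proof. by move=> x; rewrite -[x in psl_mul _ x]reprK pi_psl_mul sl_Vmul. Qed.
Lemma psl_mulV : right_inverse psl_one psl_inv psl_mul.
Proof. by move=> x; rewrite -[x in psl_mul x _]reprK pi_psl_mul sl_mulV. Qed.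

HB.instance Definition _ :=
  isGroup.Build PSL2 psl_mulA psl_mul1 psl_mulr1 psl_Vmul psl_mulV.

End SL2.

Section Hyperbolic.
Variable R : realType.

(* Upper half-space model: [(x, y, t)] stands for the point [(x + iy, t)] of
   C x ]0, +oo[. *)
Definition H3 : set (R * R * R) := [set p | 0 < p.2].

Definition sqmod (z : R[i]) : R := complex.Re z ^+ 2 + complex.Im z ^+ 2.

(* Poincare extension of the Moebius transformation z |-> (az + b) / (cz + d):
   (z, t) |-> (((az + b)(cz + d)^* + a c^* t^2) / D, t / D)
   with D = |cz + d|^2 + |c|^2 t^2. *)
Definition sl_act (M : SL2 R) (p : R * R * R) : R * R * R :=
  let z := p.1.1 +i* p.1.2 in
  let t := p.2 in
  let a := M 0 0 in let b := M 0 1 in let c := M 1 0 in let d := M 1 1 in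
  let w := (a * z + b) * (c * z + d)^* + a * c^* * (t ^+ 2)%:C in
  let D := sqmod (c * z + d) + sqmod c * t ^+ 2 in
  (complex.Re w / D, complex.Im w / D, t / D).

Definition psl_act (g : PSL2 R) (p : R * R * R) : R * R * R :=
  sl_act (repr g) p.

Lemma sl_act_opp (M : SL2 R) p : sl_act (sl_opp M) p = sl_act M p.
Proof.
have sqmodN z : sqmod (- z) = sqmod z.
  by case: z => x y; rewrite /sqmod /= !sqrrN.
by rewrite /sl_act /= !mxE !mulNr -!opprD !rmorphN /= !(mulrN, mulNr) !opprK !sqmodN.
Qed.

Lemma psl_act_pi (M : SL2 R) p : psl_act (\pi_(PSL2 R)%qT M) p = sl_act M p.
Proof.
by rewrite /psl_act; have [->|->] := repr_pi_PSL2 M; rewrite ?sl_act_opp.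
Qed.

(* The hyperbolic volume dx dy dt / t^3 of a subset of [H3]. *)
Definition hvol (A : set (R * R * R)) : \bar R :=
  (\int[(lebesgue_measure \x lebesgue_measure) \x lebesgue_measure]_(p in A)
     (p.2 ^- 3)%:E)%E.

Definition discrete_subgroup (Gamma : groupClosed (PSL2 R)) : Prop :=
  [set` Gamma] `<=` isolated [set` Gamma].

(* Measurable fundamental domains; their hyperbolic volume is the volume of
   the quotient [H3 / Gamma]. *)
Definition fundamental_domain (Gamma : groupClosed (PSL2 R))
    (D : set (R * R * R)) : Prop :=
  [/\ measurable D, D `<=` H3,
      H3 = \bigcup_(g in [set` Gamma]) (psl_act g @` D) &
      forall g, g \in Gamma -> g <> 1%g -> hvol (D `&` (psl_act g @` D)) = 0%E].

Definition finite_covolume (Gamma : groupClosed (PSL2 R)) : Prop :=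
  exists2 D, fundamental_domain Gamma D & (hvol D < +oo)%E.

(* [G] is isomorphic to the fundamental group of an orientable hyperbolic
   3-orbifold of finite volume. *)
Definition hyperbolic_3orbifold_group (G : groupType) : Prop :=
  exists Gamma : groupClosed (PSL2 R),
    [/\ discrete_subgroup Gamma, finite_covolume Gamma &
        isomorphic G (subgroup Gamma)].

End Hyperbolic.

(* Main.v *)
(* Write y_i = x_i^l and z_i = x_i^k, so that y_i z_{i+1} = y_{i+2} and z_{i+1}
   commutes with y_{i+1}. Then [y_{i+1}, y_{i+2}] = [y_i, y_{i+1}]^-1, where
   [a, b] = a b a^-1 b^-1. Given an injection of the group into PSL(2, C), the same
   holds for lifts Y_i of the y_i to SL(2, C), because commutators do not see signs.
   As n is odd, the common commutator C of the Y_i equals its inverse, hence C = 1 or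
   C = -1 in SL(2, C).
   For n > 1 no z_i or y_i is trivial, by the identity
     |M v|^2 = k^2 |v|^2 + l^2 sum_i (v_{i+2} - v_i)^2
   for the relation matrix M of the abelianization. If C = 1, then all the X_i commute
   with the non-scalar matrix Y_0, hence with each other. If C = -1, then the y_i are
   commuting involutions in the group; the identity then forces k = l, and either 3
   does not divide n and the y_i are trivial, or sending y_i to the quaternion i, j or k
   according to i mod 3 extends to a representation in SL(2, C) where y_0 and y_1 do not
   commute. So the group is abelian, hence finite as M is nonsingular.
   A finite group has infinite covolume because SL(2, C) preserves the hyperbolic volume. *)
Require Import Defs.
From HB Require Import structures.
From mathcomp Require Import all_boot all_order all_algebra.
From mathcomp Require Import all_classical all_reals all_analysis.
From mathcomp Require Import measurable_realfun complex zify ring lra.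

Set Implicit Arguments.
Unset Strict Implicit.
Unset Printing Implicit Defensive.

Import Order.TTheory GRing.Theory Num.Theory.
Import numFieldNormedType.Exports.

(** * Exponent vectors of relations *)

Section RelationLattice.
Variables n k l : nat.
Local Open Scope ring_scope.

Lemma ordS_inj : injective (@ordS n). Proof. exact: can_inj (@ordSK n). Qed.

Lemma val_iter_ordS m (i : 'I_n) : iter m (@ordS n) i = ((i + m) %% n)%N :> nat.
Proof.
elim: m => [|m IHm]; first by rewrite addn0 modn_small.
by rewrite iterS /= IHm -addn1 modnDml addn1 addnS.
Qed.

Lemma iter_ordS_n (i : 'I_n) : iter n (@ordS n) i = i.
Proof. by apply: ord_inj; rewrite val_iter_ordS modnDr modn_small. Qed.

Lemma iter_ordS_ex (i j : 'I_n) : exists m, j = iter m (@ordS n) i.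
Proof.
exists (j + (n - i))%N; apply: ord_inj; rewrite val_iter_ordS.
by rewrite addnCA subnKC ?modnDr ?modn_small // ltnW.
Qed.

Lemma ordS_ind (P : 'I_n -> Prop) (i : 'I_n) :
  P i -> (forall j, P j -> P (ordS j)) -> forall j, P j.
Proof. by move=> Pi PS j; have [m ->] := iter_ordS_ex i j; elim: m => //= m; exact: PS. Qed.

Lemma sum_ordS (V : nmodType) (F : 'I_n -> V) :
  \sum_i F (ordS i) = \sum_i F i.
Proof. by rewrite [RHS](reindex_inj ordS_inj). Qed.

(** For odd [n] the number [n + 1] is even, so the shift by one, which equals the shift by [n + 1],
    is an iterate of the double shift. *)
Lemma ordS2_const (T : Type) (v : 'I_n -> T) : odd n ->
  (forall i, v (ordS (ordS i)) = v i) -> forall i j, v i = v j.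
Proof.
move=> n_odd v2.
have vS i : v (ordS i) = v i.
  have v2m m : v (iter m.*2 (@ordS n) i) = v i.
    by elim: m => //= m; rewrite v2.
  by rewrite -[in ordS i](iter_ordS_n i) -iterS -(v2m n.+1./2) even_halfK //= n_odd.
by move=> i j; apply/esym; apply: (@ordS_ind (fun j => v j = v i) i) => // {}j <-.
Qed.

(* The lattice spanned by the exponent vectors of the relators of
   [frac_fib n k l], with [v] the vector of coefficients. *)
Definition rel_lattice (a : 'I_n -> int) : Prop :=
  exists v : 'I_n -> int, forall i,
    a (ordS (ordS i)) =
      v (ordS (ordS i)) * l%:Z + v (ordS i) * k%:Z - v i * l%:Z.

Lemma rel_lattice0 : rel_lattice (fun=> 0).
Proof. by exists (fun=> 0) => i; rewrite !mul0r subrr. Qed.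

Lemma rel_lattice_ext a b : a =1 b -> rel_lattice a -> rel_lattice b.
Proof. by move=> ab [v av]; exists v => i; rewrite -ab. Qed.

Lemma rel_latticeD a b : rel_lattice a -> rel_lattice b ->
  rel_lattice (fun i => a i + b i).
Proof. by move=> [v av] [w bw]; exists (fun i => v i + w i) => i; rewrite av bw; ring. Qed.

Lemma rel_latticeZ c a : rel_lattice a -> rel_lattice (fun i => c * a i).
Proof. by move=> [v av]; exists (fun i => c * v i) => i; rewrite av; ring. Qed.

Lemma rel_latticeB a b : rel_lattice a -> rel_lattice b ->
  rel_lattice (fun i => a i - b i).
Proof.
move=> La Lb; have := rel_latticeD La (rel_latticeZ (-1) Lb).
by apply: rel_lattice_ext => i; ring.
Qed.

Definition expo (u : word 'I_n) (i : 'I_n) : int :=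
  \sum_(a <- u) (if a.2 then -1 else 1) *+ (a.1 == i).

Lemma expo_cat u v i : expo (u ++ v) i = expo u i + expo v i.
Proof. exact: big_cat. Qed.

Lemma expo_pow i m j : expo (word_pow i m) j = m%:Z *+ (i == j).
Proof.
rewrite /expo big_nseq iter_addr_0 /= -mulrnA mulnC mulrnA; congr (_ *+ _).
by rewrite -natz.
Qed.

Lemma expo_relator i : rel_lattice (fun j =>
  expo (word_pow i l ++ word_pow (ordS i) k) j - expo (word_pow (ordS (ordS i)) l) j).
Proof.
exists (fun j => (i == j)%:R) => j; rewrite expo_cat !expo_pow !(inj_eq ordS_inj).
rewrite -[_ *+ (i == ordS _)]mulr_natr -[_ *+ (i == ordS j)]mulr_natr.
by rewrite -[_ *+ (i == j)]mulr_natr; ring.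
Qed.

(** Passing to the abelianization: each rule of [pres_eq] moves the exponent vector by a lattice
    element. Showing that a word is nontrivial in the group thus becomes a question about integer
    vectors. *)
Lemma pres_eq_expo u v : pres_eq (@frac_fib_rel n k l) u v ->
  rel_lattice (fun i => expo u i - expo v i).
Proof.
elim=> {u v} [u|u v _ L|u v w _ L1 _ L2|u u' v v' _ L1 _ L2|a|u v [i [-> ->]]].
- by apply: rel_lattice_ext rel_lattice0 => i; rewrite subrr.
- by apply: rel_lattice_ext (rel_latticeZ (-1) L) => i; ring.
- by apply: rel_lattice_ext (rel_latticeD L1 L2) => i; ring.
- by apply: rel_lattice_ext (rel_latticeD L1 L2) => i; rewrite !expo_cat; ring.
- apply: rel_lattice_ext rel_lattice0 => i; rewrite /expo !(big_cons, big_nil)/=.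
  by case: a.2; case: (_ == _) => /=; ring.
- exact: expo_relator.
Qed.

(* Cross terms cancel because the cyclic shift is orthogonal. *)
Lemma rel_lattice_energy (a v : 'I_n -> int) :
  (forall i, a (ordS (ordS i)) =
     v (ordS (ordS i)) * l%:Z + v (ordS i) * k%:Z - v i * l%:Z) ->
  \sum_i a i ^+ 2 = k%:Z ^+ 2 * (\sum_i v i ^+ 2) +
     l%:Z ^+ 2 * (\sum_i (v (ordS (ordS i)) - v i) ^+ 2).
Proof.
move=> av; have S2 (F : 'I_n -> int) : \sum_i F (ordS (ordS i)) = \sum_i F i :> int.
  by rewrite (sum_ordS (fun i => F (ordS i))) sum_ordS.
have <- : \sum_i v (ordS i) ^+ 2 = \sum_i v i ^+ 2.
  exact: (sum_ordS (fun i => v i ^+ 2)).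
have <- : \sum_i a (ordS (ordS i)) ^+ 2 = \sum_i a i ^+ 2.
  exact: (S2 (fun i => a i ^+ 2)).
rewrite !mulr_sumr -big_split /=.
have c0 : \sum_i (v (ordS i) * v (ordS (ordS i)) - v i * v (ordS i)) = 0.
  by rewrite sumrB (sum_ordS (fun i => v i * v (ordS i))) subrr.
have {}c0 : \sum_i 2 * k%:Z * l%:Z *
    (v (ordS i) * v (ordS (ordS i)) - v i * v (ordS i)) = 0.
  by rewrite -mulr_sumr c0 mulr0.
rewrite -[RHS]addr0 -[X in _ = _ + X]c0 -big_split /=.
by apply: eq_bigr => i _; rewrite av; ring.
Qed.

(** Every relator has total exponent [l + k - l = k]. *)
Lemma rel_lattice_sum (a v : 'I_n -> int) :
  (forall i, a (ordS (ordS i)) =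
     v (ordS (ordS i)) * l%:Z + v (ordS i) * k%:Z - v i * l%:Z) ->
  \sum_i a i = k%:Z * \sum_i v i.
Proof.
move=> av; have S2 (F : 'I_n -> int) : \sum_i F (ordS (ordS i)) = \sum_i F i :> int.
  by rewrite (sum_ordS (fun i => F (ordS i))) sum_ordS.
rewrite -(S2 a) (eq_bigr _ (fun i _ => av i)) sumrB big_split/= -!mulr_suml S2.
by rewrite (sum_ordS v); ring.
Qed.

Lemma sum_delta_sqr (c : int) (i : 'I_n) : \sum_j (c *+ (i == j)) ^+ 2 = c ^+ 2.
Proof.
rewrite (bigD1 i) //= eqxx big1 ?addr0 // => j ji.
by rewrite eq_sym (negbTE ji) expr0n.
Qed.

Lemma sum_delta (c : int) (i : 'I_n) : \sum_j (c *+ (i == j)) = c.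
Proof.
rewrite (bigD1 i) //= eqxx big1 ?addr0 // => j ji.
by rewrite eq_sym (negbTE ji).
Qed.

Lemma sum_sqr_eq0 (v : 'I_n -> int) : \sum_i v i ^+ 2 = 0 -> forall i, v i = 0.
Proof.
move=> v0 i; have /psumr_eq0P : forall j, true -> 0 <= v j ^+ 2 by move=> *; exact: sqr_ge0.
by move=> /(_ v0 i isT)/eqP; rewrite sqrf_eq0 => /eqP.
Qed.

Lemma sum_sqr_ge0 (v : 'I_n -> int) : 0 <= \sum_i v i ^+ 2.
Proof. by apply: sumr_ge0 => i _; exact: sqr_ge0. Qed.

Lemma sum_const_sqr (v : 'I_n -> int) (i : 'I_n) : (forall i j, v i = v j) ->
  \sum_j v j ^+ 2 = n%:Z * v i ^+ 2.
Proof.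
move=> vc; rewrite (eq_bigr (fun=> v i ^+ 2)) => [|j _]; last by rewrite (vc j i).
by rewrite sumr_const card_ord -mulr_natl natz.
Qed.

Lemma sum_const (v : 'I_n -> int) (i : 'I_n) : (forall i j, v i = v j) ->
  \sum_j v j = n%:Z * v i.
Proof.
move=> vc; rewrite (eq_bigr (fun=> v i)) => [|j _]; last by rewrite (vc j i).
by rewrite sumr_const card_ord -mulr_natl natz.
Qed.

(** The energy identity reads [k^2 = k^2 s + l^2 t], which forces [s = 1] and [t = 0]. Then [v] is
    constant because [n] is odd, and [s = n v_i^2] cannot be 1 for [n > 1]. *)
Lemma rel_lattice_k (i : 'I_n) : odd n -> (1 < n)%N -> (0 < k)%N -> (0 < l)%N ->
  ~ rel_lattice (fun j => k%:Z *+ (i == j)).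
Proof.
move=> n_odd n1 k0 l0 [v av].
have := @rel_lattice_energy (fun j => k%:Z *+ (i == j)) v av; rewrite sum_delta_sqr.
set s := \sum_i v i ^+ 2; set t := \sum_i _ ^+ 2.
have s0 : 0 <= s by exact: sum_sqr_ge0.
have t0 : 0 <= t by exact: (sum_sqr_ge0 (fun i => v (ordS (ordS i)) - v i)).
have [s00 E|sn0 E] := eqVneq s 0.
  have t00 : t = 0.
    rewrite /t big1 // => j _; have v0 := sum_sqr_eq0 s00.
    by rewrite !v0 subrr expr0n.
  by move: E; rewrite s00 t00; nia.
have t00 : t = 0 by nia.
have vc : forall i j, v i = v j.
  apply: ordS2_const => // j; apply/eqP; rewrite -subr_eq0; apply/eqP.
  exact: (@sum_sqr_eq0 (fun i => v (ordS (ordS i)) - v i)).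
have := sum_const_sqr i vc; rewrite -/s => sE.
have s1 : s = 1 by nia.
have : n%:Z * v i ^+ 2 = 1 by rewrite -sE.
nia.
Qed.

(** After division by [d], the energy and the total exponent give [4 = k'^2 s + l'^2 t] and
    [2 = k' r], which leave very few possibilities. *)
Lemma rel_lattice_2gcd (i : 'I_n) (d := gcdn k l) :
  odd n -> (1 < n)%N -> (0 < k)%N -> (0 < l)%N ->
  rel_lattice (fun j => (d.*2)%:Z *+ (i == j)) -> k = l.
Proof.
move=> n_odd n1 k0 l0 [v av].
have := @rel_lattice_energy (fun j => (d.*2)%:Z *+ (i == j)) v av.
have := @rel_lattice_sum (fun j => (d.*2)%:Z *+ (i == j)) v av.
rewrite sum_delta_sqr sum_delta.
set s := \sum_i v i ^+ 2; set t := \sum_i _ ^+ 2; set r := \sum_i v i => Er E.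
have s0 : 0 <= s by exact: sum_sqr_ge0.
have t0 : 0 <= t by exact: (sum_sqr_ge0 (fun i => v (ordS (ordS i)) - v i)).
have d0 : (0 < d)%N by rewrite gcdn_gt0 k0.
have [k' kE] : exists k', k = (k' * d)%N by apply/dvdnP; exact: dvdn_gcdl.
have [l' lE] : exists l', l = (l' * d)%N by apply/dvdnP; exact: dvdn_gcdr.
have {}Er : 2 = k'%:Z * r by nia.
have {}E : 4 = k'%:Z ^+ 2 * s + l'%:Z ^+ 2 * t.
  have : d%:Z ^+ 2 * 4 = d%:Z ^+ 2 * (k'%:Z ^+ 2 * s + l'%:Z ^+ 2 * t) by nia.
  by apply: mulfI; nia.
have k'0 : (0 < k')%N by nia.
have l'0 : (0 < l')%N by nia.
(* If [t = 0], then [v] is constant, so [n] divides [r] and hence 2, against [n] odd and [n > 1]. *)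
have [t00|tn0] := eqVneq t 0.
  have vc : forall i j, v i = v j.
    apply: ordS2_const => // j; apply/eqP; rewrite -subr_eq0; apply/eqP.
    exact: (@sum_sqr_eq0 (fun i => v (ordS (ordS i)) - v i)).
  have := sum_const i vc; rewrite -/r => rE.
  exfalso; move: Er; rewrite rE mulrA -PoszM => Er.
  have : (n %| 2)%N.
    have -> : 2%N = (n * (k' * `|v i|))%N by nia.
    exact: dvdn_mulr.
  by rewrite dvdn_divisors // !inE => /orP[]/eqP nE; move: n1 n_odd; rewrite nE.
have [s00|sn0] := eqVneq s 0.
  have v0 := sum_sqr_eq0 s00.
  by move: tn0; rewrite /t big1 ?eqxx // => j _; rewrite !v0 subrr expr0n.
(* As [s] and [t] are at least 1, a value of 2 or more for [k'] or [l'] would push the right-hand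
   side above 4. *)
have k'1 : k' = 1%N by nia.
have l'1 : l' = 1%N by nia.
by rewrite kE lE k'1 l'1.
Qed.

End RelationLattice.

(** * Lifts of PSL(2, C) to SL(2, C) *)

Section Matrix2.
Variable F : fieldType.
Implicit Types A B : 'M[F]_2.
Local Open Scope ring_scope.

Lemma mulmx2E A B i j : (A *m B) i j = A i 0 * B 0 j + A i 1 * B 1 j.
Proof. by rewrite mxE !big_ord_recl big_ord0 addr0; congr (_ + A _ _ * B _ _); exact: val_inj. Qed.

Lemma mx2P A B : A 0 0 = B 0 0 -> A 0 1 = B 0 1 -> A 1 0 = B 1 0 ->
  A 1 1 = B 1 1 -> A = B.
Proof.
move=> h00 h01 h10 h11; apply/matrixP.
have ord2 (i : 'I_2) : i = 0 \/ i = 1.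
  by case: i => [[|[|//]] ?]; [left | right]; exact: val_inj.
by move=> i j; have [->|->] := ord2 i; have [->|->] := ord2 j.
Qed.

Lemma mx2_eqE A B : A = B <->
  [/\ A 0 0 = B 0 0, A 0 1 = B 0 1, A 1 0 = B 1 0 & A 1 1 = B 1 1].
Proof. by split=> [->|[? ? ? ?]] //; exact: mx2P. Qed.

Lemma det_mx2E A : \det A = A 0 0 * A 1 1 - A 0 1 * A 1 0.
Proof.
rewrite (expand_det_row _ 0) !big_ord_recl big_ord0 addr0 /cofactor !det_mx11 !mxE /=.
rewrite expr0 expr1 mul1r mulN1r mulrN.
by congr (_ * A _ _ - A _ _ * A _ _); exact: val_inj.
Qed.

Lemma mxtrace2E A : \tr A = A 0 0 + A 1 1.
Proof. by rewrite /mxtrace !big_ord_recl big_ord0 addr0; congr (_ + A _ _); exact: val_inj. Qed.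

(** Parallelism in [F^3], written as the vanishing of the 2 by 2 minors, is transitive through a
    nonzero vector: division by its nonzero coordinate expresses the remaining coordinates. *)
Lemma parallel_trans (p q r x y z u v w : F) :
  (p != 0) || (q != 0) || (r != 0) ->
  p * y = q * x -> p * z = r * x -> q * z = r * y ->
  p * v = q * u -> p * w = r * u -> q * w = r * v ->
  [/\ x * v = y * u, x * w = z * u & y * w = z * v].
Proof.
have divE (a b c : F) : a != 0 -> a * b = c -> b = c / a.
  by move=> a0 <-; rewrite mulrAC divff ?mul1r.
move=> /orP[/orP[]|] nz e1 e2 e3 e4 e5 e6.
- move: e1 e2 e4 e5 => /(divE _ _ _ nz)-> /(divE _ _ _ nz)->.
  by move=> /(divE _ _ _ nz)-> /(divE _ _ _ nz)->; split; ring.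
- move: (esym e1) e3 (esym e4) e6 => /(divE _ _ _ nz)-> /(divE _ _ _ nz)->.
  by move=> /(divE _ _ _ nz)-> /(divE _ _ _ nz)->; split; ring.
- move: (esym e2) (esym e3) (esym e5) (esym e6) => /(divE _ _ _ nz)-> /(divE _ _ _ nz)->.
  by move=> /(divE _ _ _ nz)-> /(divE _ _ _ nz)->; split; ring.
Qed.

(* The entries of [A *m B - B *m A] are, up to sign, the coordinates of the
   cross product of the vectors (A01, A10, A00 - A11) and (B01, B10, B00 - B11). *)
Lemma mulmx2_commE A B : A *m B = B *m A <->
  [/\ A 0 1 * B 1 0 = A 1 0 * B 0 1,
      A 0 1 * (B 0 0 - B 1 1) = (A 0 0 - A 1 1) * B 0 1 &
      A 1 0 * (B 0 0 - B 1 1) = (A 0 0 - A 1 1) * B 1 0].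
Proof.
rewrite mx2_eqE !mulmx2E; split=> [[h1 h2 h3 h4]|[h1 h2 h3]].
  have {}h1 : A 0 1 * B 1 0 = A 1 0 * B 0 1.
    by apply: (addrI (A 0 0 * B 0 0)); rewrite h1; ring.
  split=> //; apply/eqP; rewrite -subr_eq0; apply/eqP.
    by move/eqP: h2; rewrite -subr_eq0 => /eqP h2; rewrite -[RHS]oppr0 -h2; ring.
  by move/eqP: h3; rewrite -subr_eq0 => /eqP h3; rewrite -h3; ring.
split; apply/eqP; rewrite -subr_eq0; apply/eqP.
- by move/eqP: h1; rewrite -subr_eq0 => /eqP h1; rewrite -h1; ring.
- by move/eqP: h2; rewrite -subr_eq0 => /eqP h2; rewrite -[RHS]oppr0 -h2; ring.
- by move/eqP: h3; rewrite -subr_eq0 => /eqP h3; rewrite -h3; ring.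
- by move/eqP: h1; rewrite -subr_eq0 => /eqP h1; rewrite -[RHS]oppr0 -h1; ring.
Qed.

(** By [mulmx2_commE] commuting is parallelism of the associated vectors, and the vector of [A]
    vanishes only if [A] is scalar. *)
Lemma centralizer_mx2_comm A B B' :
  (forall c, A != c%:M) -> A *m B = B *m A -> A *m B' = B' *m A ->
  B *m B' = B' *m B.
Proof.
move=> Ans /mulmx2_commE[h1 h2 h3] /mulmx2_commE[g1 g2 g3].
apply/mulmx2_commE; apply: (parallel_trans _ h1 h2 h3 g1 g2 g3).
apply: contraT; rewrite !negb_or !negbK subr_eq0.
move=> /andP[/andP[/eqP a01 /eqP a10] /eqP a00].
case/eqP: (Ans (A 0 0)).
by apply: mx2P; rewrite !mxE //= ?mulr1n ?mulr0n.
Qed.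

(** Cayley-Hamilton, checked on the entries. *)
Lemma det1_trace0_sqr A : \det A = 1 -> \tr A = 0 -> A *m A = - 1%:M.
Proof.
rewrite det_mx2E mxtrace2E => dA /eqP; rewrite addr_eq0 => /eqP tA.
apply: mx2P; rewrite mulmx2E !mxE /= ?mulr1n ?mulr0n ?oppr0.
- by rewrite -dA tA; ring.
- by rewrite tA; ring.
- by rewrite tA; ring.
- by rewrite -dA tA; ring.
Qed.

Lemma mulmx_scalar_imag A (a b c d : F) : A *m A = - 1%:M ->
  (a%:M + b *: A) *m (c%:M + d *: A) = (a * c - b * d)%:M + (a * d + b * c) *: A.
Proof.
move=> A2; rewrite mulmxDl !mulmxDr -scalar_mxM mul_scalar_mx mul_mx_scalar.
rewrite -scalemxAl -scalemxAr A2 !scalerA scalerN scale_scalar_mx mulr1.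
by rewrite (addrC (_ *: A) (- _)) addrACA -scalerDl (mulrC c b) raddfB.
Qed.

Lemma det_scalar_imag A (a b : F) : \det A = 1 -> \tr A = 0 ->
  \det (a%:M + b *: A) = a ^+ 2 + b ^+ 2.
Proof.
rewrite mxtrace2E !det_mx2E => dA /eqP; rewrite addr_eq0 => /eqP tA.
rewrite !mxE /= ?mulr1n ?mulr0n -[b ^+ 2]mulr1 -dA tA; ring.
Qed.

End Matrix2.

Section SL2Group.
Variable R : realType.
Local Open Scope ring_scope.
Local Open Scope quotient_scope.
Implicit Types M N : SL2 R.

Lemma sl_scalar_pm1 M c : slval M = c%:M -> M = 1%g \/ M = sl_opp 1%g.
Proof.
move=> Mc; have := sl_det M; rewrite Mc det_scalar => /eqP; rewrite sqrf_eq1.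
by move=> /orP[]/eqP cE; [left | right]; apply/val_inj; rewrite /= Mc cE // raddfN.
Qed.

Lemma sl_oppM M N : (sl_opp M * N)%g = sl_opp (M * N)%g.
Proof. by apply/val_inj; rewrite /= mulNmx. Qed.

Lemma sl_mulopp M N : (M * sl_opp N)%g = sl_opp (M * N)%g.
Proof. by apply/val_inj; rewrite /= mulmxN. Qed.

Lemma sl_oppV M : (sl_opp M)^-1%g = sl_opp M^-1%g.
Proof. by apply: mulg1_eq; rewrite sl_oppM sl_mulopp sl_oppK mulgV. Qed.

Lemma sl_commg_oppr M N : [~ M, sl_opp N]%g = [~ M, N]%g.
Proof. by rewrite !commgEl !conjgE sl_oppV !(sl_oppM, sl_mulopp) sl_oppK. Qed.

(** By Cayley-Hamilton, [M^2 = t M - 1] with [t] the trace, so [t M = 2]. Hence [t] is nonzero and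
    [M] is scalar. *)
Lemma sl_invol M : (M * M = 1)%g -> M = 1%g \/ M = sl_opp 1%g.
Proof.
move=> /(congr1 val) /mx2_eqE /=; rewrite !mulmx2E !mxE /= ?mulr1n ?mulr0n.
have := sl_det M; rewrite det_mx2E => dM [h1 h2 h3 h4].
set t := M 0 0 + M 1 1; have t0 : t != 0.
  apply: contra_eqN (h1) => /eqP; rewrite /t => /eqP; rewrite addr_eq0 => /eqP tE.
  have -> : M 0 0 * M 0 0 + M 0 1 * M 1 0 = - (M 0 0 * M 1 1 - M 0 1 * M 1 0).
    by rewrite tE; ring.
  by rewrite dM eq_sym -addr_eq0 -mulr2n pnatr_eq0.
have M01 : M 0 1 = 0 by apply: (mulfI t0); rewrite mulr0 -h2 /t; ring.
have M10 : M 1 0 = 0 by apply: (mulfI t0); rewrite mulr0 -h3 /t; ring.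
have M00 : M 0 0 = M 1 1.
  apply: (mulfI t0); apply/eqP; rewrite -subr_eq0 -h4 in h1 *; apply/eqP.
  by move/eqP: h1; rewrite -subr_eq0 => /eqP <-; rewrite /t; ring.
apply: (@sl_scalar_pm1 _ (M 0 0)).
by apply: mx2P; rewrite !mxE /= ?mulr1n ?mulr0n.
Qed.

Definition psl_pi (M : SL2 R) : PSL2 R := \pi_(PSL2 R) M.

Lemma psl_piM M N : psl_pi (M * N)%g = (psl_pi M * psl_pi N)%g.
Proof. exact/esym/pi_psl_mul. Qed.

Lemma psl_piX M m : psl_pi (M ^+ m)%g = (psl_pi M ^+ m)%g.
Proof. by elim: m => // m IHm; rewrite !expgS psl_piM IHm. Qed.

Lemma psl_pi_eq M N : psl_pi M = psl_pi N -> M = N \/ M = sl_opp N.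
Proof. by move=> /eqP/PSL2_eqP. Qed.

Lemma psl_pi_opp M : psl_pi (sl_opp M) = psl_pi M.
Proof. by apply/eqP/PSL2_eqP; right. Qed.

Lemma psl_pi_repr (g : PSL2 R) : psl_pi (repr g) = g.
Proof. exact: reprK. Qed.

Lemma sl_nonscalar M : psl_pi M <> 1%g -> forall c, slval M != c%:M.
Proof.
move=> M1 c; apply/eqP => /sl_scalar_pm1[] ME; apply: M1; rewrite ME //.
by rewrite psl_pi_opp.
Qed.

Lemma sl_centralizer_comm M N N' : psl_pi M <> 1%g ->
  commute M N -> commute M N' -> commute N N'.
Proof.
move=> /sl_nonscalar Mns /(congr1 val) MN /(congr1 val) MN'; apply/val_inj => /=.
exact: centralizer_mx2_comm Mns MN MN'.
Qed.

Lemma sl_opp_neq M : sl_opp M <> M.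
Proof.
move=> /(congr1 val)/= /eqP; rewrite eq_sym -addr_eq0 -mulr2n -scaler_nat scalemx_eq0.
rewrite pnatr_eq0 /= => /eqP M0; have := sl_det M; rewrite M0 det0 => /eqP.
by rewrite eq_sym oner_eq0.
Qed.

(** Conjugation by [N] sends [M] to its opposite but preserves the trace. *)
Lemma sl_anticomm_trace M N : (M * N)%g = sl_opp (N * M)%g -> \tr (slval M) = 0.
Proof.
move=> MN; have /(congr1 val)/= E : M = sl_opp (N * (M * N^-1))%g.
  by apply: (mulIg N); rewrite sl_oppM !mulgA mulgVK.
have /eqP : \tr (slval M) = - \tr (slval M).
  rewrite [in LHS]E raddfN/= mxtrace_mulC -mulmxA mulVmx ?sl_unit //.
  by rewrite mulmx1.
by rewrite -addr_eq0 -mulr2n mulrn_eq0 /= => /eqP.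
Qed.

Lemma sl_trace0_sqr M : \tr (slval M) = 0 -> (M * M)%g = sl_opp 1%g.
Proof. by move=> M0; apply/val_inj; exact: det1_trace0_sqr (sl_det M) M0. Qed.

(* [M] plays the role of the imaginary unit in de Moivre's formula. *)
Lemma sl_trace0_root M m : (0 < m)%N -> \tr (slval M) = 0 ->
  exists N, (N ^+ m)%g = M.
Proof.
move=> m0 M0; pose rot t := (cos t)%:C%C%:M + (sin t)%:C%C *: slval M.
have M2 : slval M *m slval M = - 1%:M by exact: det1_trace0_sqr (sl_det M) M0.
have rotD s t : rot s *m rot t = rot (s + t).
  have cE : (cos (s + t))%:C%C = (cos s)%:C%C * (cos t)%:C%C - (sin s)%:C%C * (sin t)%:C%C.
    by rewrite cosD -!rmorphM -rmorphB.
  have sE : (sin (s + t))%:C%C = (cos s)%:C%C * (sin t)%:C%C + (sin s)%:C%C * (cos t)%:C%C.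
    by rewrite sinD addrC -!rmorphM -rmorphD.
  by rewrite /rot cE sE; exact: mulmx_scalar_imag.
have det_rot t : \det (rot t) == 1.
  rewrite det_scalar_imag ?sl_det // -!rmorphXn -rmorphD cos2Dsin2.
  by rewrite rmorph1.
(* With this angle, [m] steps make a rotation by [pi / 2], where the cosine is 0 and the sine is 1,
   so that only [M] remains. *)
pose t : R := pi / 2 / m%:R; exists (MkSL2 (det_rot t)); apply/val_inj.
have powE j : slval (MkSL2 (det_rot t) ^+ j)%g = rot (j%:R * t).
  elim: j => [|j IHj].
    by rewrite mul0r /rot cos0 sin0 expg0 /= rmorph0 rmorph1 scale0r addr0.
  by rewrite expgS /= IHj rotD -nat1r mulrDl mul1r.
rewrite [LHS]powE /t mulrC divfK ?pnatr_eq0 -?lt0n // /rot cos_pihalf sin_pihalf.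
by rewrite rmorph0 rmorph1 scale1r; apply/matrixP => i j; rewrite !mxE add0r.
Qed.

End SL2Group.

(** * Representations of fractional Fibonacci groups *)

(** As [[~ x, y]] is [x^-1 y^-1 x y], the commutator [b a b^-1 a^-1] is written with inverted
    arguments. In [b (a z) b^-1 (a z)^-1] the factor [z] passes through [b^-1] and cancels. *)
Lemma commg_mulr_commute (H : groupType) (a b z : H) : commute b z ->
  [~ b^-1, (a * z)^-1]%g = [~ b^-1, a^-1]%g.
Proof.
move=> bz; rewrite !commgEl !conjgE !invgK; congr (_ * _)%g.
rewrite invgM -!mulgA; congr (_ * _)%g; rewrite !mulgA; congr (_ * _)%g.
by rewrite (commuteV (commute_sym bz)) mulgK.
Qed.

Section FracFibWords.
Variables n k l : nat.
Local Open Scope group_scope.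
Local Open Scope quotient_scope.
Local Notation G := (frac_fib n k l).
Local Notation rels := (@frac_fib_rel n k l).

Definition fgen (i : 'I_n) : G := pres_gen rels i.

Lemma fgen_rel i : fgen i ^+ l * fgen (ordS i) ^+ k = fgen (ordS (ordS i)) ^+ l.
Proof. exact: frac_fib_relation. Qed.

Lemma fgen_powE i m : fgen i ^+ m = \pi_(presented rels) (word_pow i m).
Proof. exact/esym/pi_word_pow. Qed.

Lemma pi_fword_cons (a : 'I_n * bool) u :
  \pi_(presented rels) (a :: u) =
  (if a.2 then (fgen a.1)^-1 else fgen a.1) * \pi_(presented rels) u :> G.
Proof.
rewrite -cat1s -pi_pres_mul; congr (_ * _ : G); case: a => i [] //=.
apply: (@mulgI G (fgen i)); rewrite mulgV [LHS]pi_pres_mul.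
by apply/eqP/presented_eqP; exact: (@pres_cancel _ _ (i, false)).
Qed.

Lemma fword_ind (P : G -> Prop) : P 1 ->
  (forall i x, P x -> P (fgen i * x)) -> (forall i x, P x -> P ((fgen i)^-1 * x)) ->
  forall x, P x.
Proof.
move=> P1 Pg PV; elim/quotW; elim=> [//|[i b] u Pu].
by rewrite [\pi _]pi_fword_cons; case: b => /=; [exact: PV | exact: Pg].
Qed.

Lemma fgen_commute_abelian : (forall i j, commute (fgen i) (fgen j)) ->
  forall x y : G, commute x y.
Proof.
move=> cg; have cgx i x : commute (fgen i) x.
  elim/fword_ind: x => [|j x|j x]; first exact: commute1.
    exact: commuteM.
  by apply: commuteM; apply: commuteV.
move=> x y; elim/fword_ind: x => [|j x IH|j x IH]; apply: commute_sym.
- exact: commute1.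
- by apply: commuteM; apply: commute_sym => //; exact: cgx.
- by apply: commuteM; [apply: commuteV|]; apply: commute_sym => //; exact: cgx.
Qed.

Lemma word_eval_pow (H : groupType) (f : 'I_n -> H) i m :
  word_eval f (word_pow i m) = f i ^+ m.
Proof. by elim: m => //= m IHm; rewrite IHm expgS. Qed.

Lemma frac_fib_eval (H : groupType) (f : 'I_n -> H) :
  (forall i, f i ^+ l * f (ordS i) ^+ k = f (ordS (ordS i)) ^+ l) ->
  forall u v, \pi_(presented rels) u = \pi_(presented rels) v ->
  word_eval f u = word_eval f v.
Proof.
move=> fr u v /eqP/presented_eqP; apply: pres_eq_eval => {u v} _ _ [i [-> ->]].
by rewrite word_eval_cat !word_eval_pow.
Qed.

Lemma fgen_pow1_lattice i m : fgen i ^+ m = 1 ->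
  rel_lattice k l (fun j => (m%:Z *+ (i == j))%R).
Proof.
rewrite fgen_powE => /eqP/presented_eqP/pres_eq_expo; apply: rel_lattice_ext => j.
by rewrite expo_pow /expo big_nil subr0.
Qed.

(** The relations are invariant under [i |-> i + 1], so evaluation at the shifted generators
    respects equality in the group and carries the equation from one generator to the next. *)
Lemma fgen_pow1_shift i m : fgen i ^+ m = 1 -> forall j, fgen j ^+ m = 1.
Proof.
move=> i1; apply: (@ordS_ind _ _ i) => // j; rewrite fgen_powE => j1.
have := @frac_fib_eval G (fun j => fgen (ordS j)) (fun i => fgen_rel (ordS i)) _ _ j1.
by rewrite word_eval_pow.
Qed.

Lemma fgen_powk_neq1 i : odd n -> (1 < n)%N -> (0 < k)%N -> (0 < l)%N ->
  fgen i ^+ k <> 1.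
Proof. by move=> n_odd n1 k0 l0 /fgen_pow1_lattice; exact: rel_lattice_k. Qed.

(** If one [y_i] is trivial, all are by cyclic symmetry, and the relation then leaves
    [x_{i+1}^k = 1], already excluded. *)
Lemma fgen_powl_neq1 i : odd n -> (1 < n)%N -> (0 < k)%N -> (0 < l)%N ->
  fgen i ^+ l <> 1.
Proof.
move=> n_odd n1 k0 l0 /fgen_pow1_shift l1.
apply: (@fgen_powk_neq1 (ordS i) n_odd n1 k0 l0).
by have := fgen_rel i; rewrite !l1 mul1g.
Qed.

End FracFibWords.

Section Representation.
Variables (R : realType) (n k l : nat).
Variable f : UMagmaMorphism.type (frac_fib n k l) (PSL2 R).
Hypotheses (f_inj : injective f) (n_odd : odd n) (n_gt1 : (1 < n)%N).
Hypotheses (k_gt0 : (0 < k)%N) (l_gt0 : (0 < l)%N).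
Local Open Scope group_scope.
Local Notation G := (frac_fib n k l).
Local Notation x := (@fgen n k l).
Local Notation y i := (x i ^+ l).
Local Notation m1 := (sl_opp (1 : SL2 R)).

Let X i : SL2 R := repr (f (x i)).
Let Y i : SL2 R := X i ^+ l.

Let piX i : psl_pi (X i) = f (x i). Proof. exact: psl_pi_repr. Qed.
Let piY i : psl_pi (Y i) = f (y i). Proof. by rewrite psl_piX piX gmulfXn. Qed.

Let Y_neq1 i : psl_pi (Y i) <> 1.
Proof.
rewrite piY -(@gmulf1 _ _ f) => /f_inj; exact: fgen_powl_neq1.
Qed.

Let XYcomm i : commute (X i) (Y i). Proof. exact: commuteX. Qed.

Let Yrel i : Y i * X (ordS i) ^+ k = Y (ordS (ordS i)) \/
  Y i * X (ordS i) ^+ k = sl_opp (Y (ordS (ordS i))).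
Proof.
apply: psl_pi_eq; rewrite psl_piM psl_piX piX !piY -gmulfXn -gmulfM.
by rewrite fgen_rel.
Qed.

Let C i := [~ (Y i)^-1, (Y (ordS i))^-1].

(* The sign ambiguity of the lifts does not affect commutators. *)
Let C_ordS i : C (ordS i) = (C i)^-1.
Proof.
rewrite /C invgR.
have cX : commute (Y (ordS i)) (X (ordS i) ^+ k).
  exact/commuteX/commute_sym/XYcomm.
transitivity [~ (Y (ordS i))^-1, (Y i * X (ordS i) ^+ k)^-1].
  by have [->|->] := Yrel i; rewrite // sl_oppV sl_commg_oppr.
exact: commg_mulr_commute.
Qed.

Let C_const i j : C i = C j.
Proof.
have CC i' : C (ordS (ordS i')) = C i' by rewrite !C_ordS invgK.
exact: (ordS2_const n_odd CC).
Qed.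

Let C_pm1 i : C i = 1 \/ C i = m1.
Proof.
by apply: sl_invol; rewrite -[X in X * _]invgK -C_ordS (C_const _ i) mulVg.
Qed.

(** Commutation spreads around the cycle: whatever commutes with the non-scalar [Y j] commutes with
    everything else that does, in particular with [Y (ordS j)] and with [X j], of which [Y j] is a
    power. *)
Let Y_commute_abelian : (forall i, commute (Y i) (Y (ordS i))) ->
  forall u v : G, commute u v.
Proof.
move=> cY; apply: fgen_commute_abelian => i j.
have cYY : forall j, commute (Y i) (Y j).
  apply: (@ordS_ind _ _ i) => // j' cij.
  exact: (sl_centralizer_comm (@Y_neq1 j') (commute_sym cij) (cY j')).
have cXY : forall j, commute (Y i) (X j).
  move=> j'; apply: (sl_centralizer_comm (@Y_neq1 j') (commute_sym (cYY j'))).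
  exact/commute_sym/XYcomm.
have cXX := sl_centralizer_comm (@Y_neq1 i) (cXY i) (cXY j).
by apply: f_inj; rewrite !gmulfM -!piX -!psl_piM cXX.
Qed.

Let Y_anticommute i : C i = m1 -> Y i * Y (ordS i) = sl_opp (Y (ordS i) * Y i).
Proof.
move=> CE; rewrite -[in RHS](mul1g (_ * _)) -sl_oppM -CE /C commgEl conjgE !invgK.
by rewrite !mulgA !mulgVK.
Qed.

(** * The case of anticommuting lifts *)

Section Anticommuting.
Hypothesis anti : forall i, Y i * Y (ordS i) = sl_opp (Y (ordS i) * Y i).

Let y_sqr i : y i * y i = 1.
Proof.
apply: f_inj; rewrite gmulfM -piY -psl_piM (sl_trace0_sqr (sl_anticomm_trace (anti i))).
by rewrite psl_pi_opp gmulf1.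
Qed.

Let y_comm i : commute (y i) (y (ordS i)).
Proof.
by apply: f_inj; rewrite !gmulfM -!piY -!psl_piM anti psl_pi_opp.
Qed.

(** Let [e_i] be the standard basis. Since [y_i^2 = 1], the lattice contains all [2 l e_i]. Twice a
    relator, corrected by two such vectors, gives [2 k e_i]. Bezout then yields [2 gcd(k, l) e_i],
    so [rel_lattice_2gcd] applies. *)
Let eq_kl : k = l.
Proof.
have [i0 _] : exists i : 'I_n, true by exists (Ordinal (ltnW n_gt1)).
apply: (@rel_lattice_2gcd n k l i0) => //.
have L2l (i : 'I_n) : rel_lattice k l (fun j => ((l.*2)%:Z *+ (i == j))%R).
  by apply: fgen_pow1_lattice; rewrite -addnn expgnDr y_sqr.
have L2k (i : 'I_n) : rel_lattice k l (fun j => ((k.*2)%:Z *+ (i == j))%R).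
  have [i' ->] : exists i', i = ordS i' by exists (ord_pred i); rewrite ord_predK.
  have L := rel_latticeZ 2 (@expo_relator n k l i').
  have := rel_latticeB (rel_latticeD L (L2l (ordS (ordS i')))) (L2l i').
  apply: rel_lattice_ext => j; rewrite expo_cat !expo_pow -!muln2 !PoszM.
  by case: (_ == _); case: (_ == _); case: (_ == _) => /=; ring.
have [u [v uvE]] := Bezoutz k l.
have := rel_latticeD (rel_latticeZ u (L2k i0)) (rel_latticeZ v (L2l i0)).
apply: rel_lattice_ext => j; rewrite -!muln2 !PoszM -[Posz (gcdn k l)]uvE.
by case: (_ == _) => /=; ring.
Qed.

Let y_rec i : y i * y (ordS i) = y (ordS (ordS i)).
Proof. by rewrite -fgen_rel -eq_kl. Qed.

Let y_ordS3 i : y (ordS (ordS (ordS i))) = y i.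
Proof. by rewrite -y_rec -y_rec y_comm mulgA y_sqr mul1g. Qed.

(** The [y_i] have periods 3 and [n], hence [n %% 3]. If this is 1 or 2, two of the three terms of
    some relation [y_i y_{i+1} = y_{i+2}] cancel and leave a trivial [y]. *)
Lemma anticommuting_lifts_dvd3n : 3 %| n.
Proof.
have y3m m i : y (iter (3 * m) (@ordS n) i) = y i.
  by elim: m => [|m IHm]; rewrite ?muln0 // mulnS !iterS y_ordS3.
have [i0 _] : exists i : 'I_n, true by exists (Ordinal (ltnW n_gt1)).
have yn i : y (iter (n %% 3) (@ordS n) i) = y i.
  have e : iter n (@ordS n) i = iter (3 * (n %/ 3)) (@ordS n) (iter (n %% 3) (@ordS n) i).
    by rewrite -iterD mulnC -divn_eq.
  by rewrite -(y3m (n %/ 3)) -e iter_ordS_n.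
apply: contraT => n3; have y1 : y i0 <> 1 by exact: fgen_powl_neq1.
have : n %% 3 < 3 by rewrite ltn_mod.
rewrite /dvdn in n3; case: (n %% 3) n3 yn => [|[|[|//]]] n3 yn _ //; case: y1.
- by apply: (@mulIg G (y (ordS i0))); rewrite y_rec mul1g; exact: (yn (ordS i0)).
- apply: (@mulgI G (y (ord_pred i0))); rewrite mulg1.
  by have := y_rec (ord_pred i0); have := yn (ord_pred i0); rewrite /= ord_predK => ->.
Qed.

Lemma not_anticommuting_lifts : False.
Proof.
have [i0 i0E] : exists i : 'I_n, i = 0 :> nat by exists (Ordinal (ltnW n_gt1)).
pose I := Y i0; pose J := Y (ordS i0).
have IJ : I * J = sl_opp (J * I) by exact: anti.
have JI : J * I = sl_opp (I * J) by rewrite IJ sl_oppK.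
have KI : I * J * I = sl_opp (I * (I * J)) by rewrite -mulgA JI sl_mulopp.
have I0 := sl_anticomm_trace IJ; have J0 := sl_anticomm_trace JI.
(* The values [I], [J], [I * J] are wanted for the [y_i], so the generators must be sent to [l]-th
   roots of them. *)
have [TI TIE] := sl_trace0_root l_gt0 I0.
have [TJ TJE] := sl_trace0_root l_gt0 J0.
have [TK TKE] := sl_trace0_root l_gt0 (sl_anticomm_trace KI).
pose T (i : nat) := nth TI [:: TI; TJ; TK] (i %% 3).
(* Since 3 divides [n], the assignment by residues mod 3 is consistent where the index wraps
   around. *)
have ordS_mod3 (i : 'I_n) : ordS i = i.+1 %[mod 3].
  by rewrite /= modn_dvdm // anticommuting_lifts_dvd3n.
have TS (i : 'I_n) : T (ordS i) = T i.+1 by rewrite /T ordS_mod3.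
have TSS (i : 'I_n) : T (ordS (ordS i)) = T i.+2.
  by rewrite TS /T -addn1 -modnDml ordS_mod3 modnDml addn1.
(* As [k = l], the relations involve only [l]-th powers and become the quaternion rules [I J = K],
   [J K = I], [K I = J]. *)
have T_rel (i : 'I_n) : T i ^+ l * T (ordS i) ^+ k = T (ordS (ordS i)) ^+ l.
  rewrite TS TSS eq_kl /T -[i.+2]addn2 -[i.+1]addn1 -(modnDml _ 1) -(modnDml _ 2).
  have : i %% 3 < 3 by rewrite ltn_mod.
  case: (i %% 3) => [|[|[|//]]] _ /=; rewrite ?(TIE, TJE, TKE) //.
    by rewrite mulgA JI sl_oppM -mulgA (sl_trace0_sqr J0) sl_mulopp sl_oppK mulg1.
  by rewrite KI mulgA (sl_trace0_sqr I0) sl_oppM sl_oppK mul1g.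
(* [y_0] and [y_1] commute in the group, yet their images [I] and [J] anticommute. *)
have := y_comm i0; rewrite !fgen_powE /commute [LHS]pi_pres_mul [RHS]pi_pres_mul.
move=> /(frac_fib_eval T_rel); rewrite !word_eval_cat !word_eval_pow /= i0E.
have -> : T (1 %% n)%N = TJ by rewrite modn_small.
by rewrite TIE TJE IJ; exact: sl_opp_neq.
Qed.

End Anticommuting.

Theorem rep_inj_abelian (u v : G) : commute u v.
Proof.
have i0 : 'I_n := Ordinal (ltnW n_gt1).
have [C1|Cm1] := C_pm1 i0.
  apply: Y_commute_abelian => i; have := C_const i i0; rewrite C1 => /eqP.
  move=> /commgP/commuteV/commute_sym/commuteV/commute_sym.
  by rewrite !invgK.
by case: not_anticommuting_lifts => i; apply: Y_anticommute; rewrite (C_const i i0).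
Qed.

End Representation.

(** * Finiteness in the abelian case *)

Section AbelianFinite.
Variables n k l : nat.
Hypotheses (k_gt0 : (0 < k)%N).
Local Open Scope ring_scope.

(** Row [j] is the exponent vector of the relator [x_j^l x_{j+1}^k x_{j+2}^-l]. *)
Definition rel_mx : 'M[int]_n := \matrix_(j, i)
  (l%:Z *+ (j == i) + k%:Z *+ (ordS j == i) - l%:Z *+ (ordS (ordS j) == i)).

Lemma sum_mulr_delta (v : 'I_n -> int) (c : int) (h : 'I_n -> 'I_n) i :
  injective h -> \sum_j v j * (c *+ (h j == h i)) = v i * c.
Proof.
move=> h_inj; rewrite (bigD1 i) //= eqxx big1 ?addr0 // => j ji.
by rewrite (inj_eq h_inj) (negbTE ji) mulr0.
Qed.

(** For a row vector killed by the matrix the energy identity has left-hand side 0, and its term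
    [k^2 |v|^2] forces the vector to vanish. *)
Lemma det_rel_mx_neq0 : \det rel_mx != 0.
Proof.
apply/negP => /det0P[v v0 vM].
have vE i : (fun=> 0 : int) (ordS (ordS i)) =
    v 0 (ordS (ordS i)) * l%:Z + v 0 (ordS i) * k%:Z - v 0 i * l%:Z.
  have /rowP/(_ (ordS (ordS i))) := vM; rewrite !mxE => <-.
  under eq_bigr do rewrite mxE mulrBr mulrDr.
  rewrite sumrB big_split /= (sum_mulr_delta _ _ _ (@inj_id _)).
  rewrite (sum_mulr_delta _ _ _ (@ordS_inj n)).
  by rewrite (sum_mulr_delta _ _ _ (inj_comp (@ordS_inj n) (@ordS_inj n))).
have := @rel_lattice_energy n k l (fun=> 0) (v 0) vE.
rewrite big1 => [|i _]; last by rewrite expr0n.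
have s0 := sum_sqr_ge0 (v 0).
have := sum_sqr_ge0 (fun i => v 0 (ordS (ordS i)) - v 0 i).
set t := \sum_i _ => t0 E.
have /sum_sqr_eq0 v00 : \sum_i v 0 i ^+ 2 = 0.
  by move: s0 E; set s := \sum_i _ => s0 E; nia.
by case/eqP: v0; apply/rowP => i; rewrite v00 mxE.
Qed.

(** Multiplication by the adjugate writes [\det rel_mx] times each generator as a combination of
    relations, so [N] is the absolute value of the determinant. *)
Lemma zmod_relation_torsion (A : zmodType) (a : 'I_n -> A) :
  (forall i, a i *+ l + a (ordS i) *+ k = a (ordS (ordS i)) *+ l) ->
  exists2 N, (0 < N)%N & forall i, a i *+ N = 0.
Proof.
move=> aE; exists `|\det rel_mx|%N; first by rewrite absz_gt0 det_rel_mx_neq0.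
move=> m.
have aM j : \sum_i a i *~ rel_mx j i = 0.
  have delta (c : int) i' : \sum_i a i *~ (c *+ (i' == i)) = a i' *~ c.
    rewrite (bigD1 i') //= eqxx big1 ?addr0 // => i ii'.
    by rewrite eq_sym (negbTE ii').
  under eq_bigr do rewrite mxE mulrzBr mulrzDr.
  by rewrite sumrB big_split /= !delta -!pmulrn aE subrr.
have adet : a m *~ \det rel_mx = 0.
  have <- : \sum_i a i *~ (\adj rel_mx *m rel_mx) m i = a m *~ \det rel_mx.
    rewrite mul_adj_mx (bigD1 m) //= mxE eqxx big1 ?addr0 // => i im.
    by rewrite mxE eq_sym (negbTE im).
  under eq_bigr do rewrite mxE mulrz_sumr.
  rewrite exchange_big /= big1 // => j _.
  under eq_bigr do rewrite mulrC mulrzA.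
  by rewrite -mulrz_suml aM mul0rz.
case: (\det rel_mx) adet => d; first by rewrite -pmulrn.
by rewrite NegzE mulrNz -pmulrn => /eqP; rewrite oppr_eq0 => /eqP.
Qed.

(** The list consists of the combinations with coefficients below [N]. Closure under adding [a i]
    and [- a i] is the form that [fword_ind] consumes. *)
Lemma zmod_torsion_finite (A : zmodType) (a : 'I_n -> A) N : (0 < N)%N ->
  (forall i, a i *+ N = 0) ->
  exists s : seq A, 0 \in s /\
    forall i u, u \in s -> a i + u \in s /\ - a i + u \in s.
Proof.
move=> N0 aN; pose comb (c : 'I_n -> nat) := \sum_i a i *+ c i.
exists [seq comb (fun i => c i) | c : {ffun 'I_n -> 'I_N}].
have combP (c : 'I_n -> nat) :
    comb c \in [seq comb (fun i => d i) | d : {ffun 'I_n -> 'I_N}].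
  apply/mapP; exists [ffun i => Ordinal (ltn_pmod (c i) N0)]; first by rewrite mem_enum.
  apply: eq_bigr => i _; rewrite ffunE /= {1}(divn_eq (c i) N) mulrnDr mulnC mulrnA.
  by rewrite aN mul0rn add0r.
have combD i m c : a i *+ m + comb c = comb (fun j => m * (j == i) + c j)%N.
  rewrite /comb; under [RHS]eq_bigr do rewrite mulrnDr.
  rewrite big_split /= [in RHS](bigD1 i) //= eqxx muln1 [in RHS]big1 ?addr0 // => j ji.
  by rewrite (negbTE ji) muln0.
split=> [|i _ /mapP[c _ ->]].
  by have := combP (fun=> 0%N); rewrite /comb big1.
have -> : - a i = a i *+ N.-1.
  by apply/eqP; rewrite eq_sym -subr_eq0 opprK -mulrSr prednK // aN.
by split; [rewrite -{1}[a i]mulr1n|]; rewrite combD combP.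
Qed.

Lemma abelian_frac_fib_finite :
  (forall u v : frac_fib n k l, commute u v) ->
  exists s : seq (frac_fib n k l), forall u, u \in s.
Proof.
(* Commutativity lets the same carrier be read additively, so that integer matrices act on tuples of
   its elements. *)
set G := frac_fib n k l => cG; pose A : zmodType := HB.pack G
  (GRing.isZmodule.Build G (@mulgA G) cG (@mul1g G) (@mulVg G)).
have natE (u : A) m : u *+ m = (u ^+ m)%g :> G.
  by elim: m => // m IHm; rewrite mulrS expgS IHm.
have [|N N0 aN] := @zmod_relation_torsion A (@fgen n k l).
  by move=> i; rewrite !natE; exact: fgen_rel.
have [s [s0 sP]] := zmod_torsion_finite N0 aN; exists s.
by elim/fword_ind => [//|i u /(sP i)[]|i u /(sP i)[]].
Qed.

End AbelianFinite.

(** * Invariance of the hyperbolic volume *)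

Section Lebesgue1D.
Local Open Scope classical_set_scope.
Local Open Scope ring_scope.
Variable R : realType.
Local Notation TR := (measurableTypeR R).
Local Notation lam := (@lebesgue_measure R).

(** Bundles the pushforward with its measure structure, so that [mscale] applies to it. *)
Definition pushforward_measure d d' (T1 : measurableType d) (T2 : measurableType d')
    (m : {measure set T1 -> \bar R}) (f : T1 -> T2)
    (mf : measurable_fun setT f) : {measure set T2 -> \bar R} :=
  ltac:(refine (pushforward m f : {measure set T2 -> \bar R}); exact: mf).

Lemma measurable_addr (a : R) : measurable_fun [set: TR] (fun x : TR => (x + a : TR)).
Proof. exact: measurable_funD. Qed.

Lemma measurable_mulr (a : R) : measurable_fun [set: TR] (fun x : TR => (a * x : TR)).
Proof. exact: measurable_funM. Qed.

(** Lebesgue measure is determined by its values on half-open intervals, whose length is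
    unchanged. *)
Lemma lebesgue_measure_translation (a : R) (A : set TR) : measurable A ->
  lam ((fun x => x + a) @^-1` A) = lam A.
Proof.
move=> mA.
pose phi := (fun x : TR => (x + a : TR)).
have mphi : measurable_fun setT phi := measurable_addr a.
rewrite -[LHS]/(pushforward lam phi A).
apply/esym/lebesgue_measure_unique => //= _ [[b c]] _ <-.
rewrite /pushforward (_ : _ @^-1` _ = `](b - a), (c - a)]%classic).
  rewrite !lebesgue_measure_itv/= !lte_fin ltrD2r.
  by case: ifP => // _; congr (_%:E); ring.
by apply/seteqP; split => x /=; rewrite !in_itv /= /phi ltrBlDr lerBrDr.
Qed.

Lemma lebesgue_measure_scale (a : R) (A : set TR) : 0 < a -> measurable A ->
  lam A = (a%:E * lam ((fun x => (a * x)%R) @^-1` A))%E.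
Proof.
move=> a0 mA.
pose phi := (fun x : TR => (a * x : TR)).
have mphi : measurable_fun setT phi := measurable_mulr a.
pose a' := NngNum (ltW a0).
rewrite -[RHS]/(mscale a' (pushforward_measure lam mphi) A).
apply/lebesgue_measure_unique => //= _ [[b c]] _ <-.
rewrite /mscale /= /pushforward_measure /= /pushforward (_ : _ @^-1` _ = `](b / a), (c / a)]%classic).
  rewrite !lebesgue_measure_itv/= !lte_fin ltr_pM2r ?invr_gt0//.
  case: ifP => // _; rewrite ?mule0// -EFinD -EFinM; congr (_%:E).
  by field; rewrite gt_eqF.
by apply/seteqP; split => x /=; rewrite !in_itv /= /phi ltr_pdivrMr// ler_pdivlMr// !(mulrC a).
Qed.

Lemma ge0_integral_translation (a : R) (f : TR -> \bar R) :
  measurable_fun setT f -> (forall x, 0 <= f x)%E ->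
  (\int[lam]_x f (x + a)%R = \int[lam]_x f x)%E.
Proof.
move=> mf f0; pose phi := (fun x : TR => (x + a : TR)).
have mphi : measurable_fun setT phi := measurable_addr a.
transitivity (\int[pushforward lam phi]_x f x)%E.
  by rewrite ge0_integral_pushforward.
by apply: eq_measure_integral => A mA _; exact: lebesgue_measure_translation.
Qed.

Lemma ge0_integral_opp (f : TR -> \bar R) :
  measurable_fun setT f -> (forall x, 0 <= f x)%E ->
  (\int[lam]_x f (- x)%R = \int[lam]_x f x)%E.
Proof.
move=> mf f0; pose phi := (fun x : TR => (- x : TR)).
have mphi : measurable_fun setT phi by exact: measurable_funN.
transitivity (\int[pushforward lam phi]_x f x)%E.
  by rewrite ge0_integral_pushforward.
by apply: eq_measure_integral => A mA _; exact: lebesgue_measureN.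
Qed.

Lemma ge0_integral_scale (a : R) (f : TR -> \bar R) : 0 < a ->
  measurable_fun setT f -> (forall x, 0 <= f x)%E ->
  (\int[lam]_x f x = a%:E * \int[lam]_x f (a * x)%R)%E.
Proof.
move=> a0 mf f0; pose phi := (fun x : TR => (a * x : TR)).
have mphi : measurable_fun setT phi := measurable_mulr a.
pose a' := NngNum (ltW a0).
transitivity (\int[mscale a' (pushforward_measure lam mphi)]_x f x)%E.
  by apply: eq_measure_integral => A mA _; exact: lebesgue_measure_scale.
by rewrite ge0_integral_mscale // ge0_integral_pushforward.
Qed.

End Lebesgue1D.

(** * The substitution [t = expR s] on the positive half-line *)

Section LogLebesgue.
Local Open Scope classical_set_scope.
Local Open Scope ring_scope.
Variable R : realType.
Local Notation TR := (measurableTypeR R).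
Local Notation lam := (@lebesgue_measure R).

Lemma measurable_inv_gt0 : measurable_fun (`]0, +oo[%classic : set R) (fun x : R => x^-1).
Proof.
apply: open_continuous_measurable_fun; first exact: interval_open.
by move=> x; rewrite inE/= in_itv/= andbT => x0; apply: inv_continuous; rewrite gt_eqF.
Qed.

(** This is the image of [B] under [expR]. The intersection discards the points where [ln] only has
    a default value. *)
Let posln (B : set TR) : set TR := `]0, +oo[%classic `&` (@ln R) @^-1` B.

Let measurable_posln B : measurable B -> measurable (posln B).
Proof.
move=> mB; apply: measurableI; first exact: measurable_itv.
by rewrite -[X in measurable X]setTI; exact: measurable_ln.
Qed.

(** The measure [dt / t] carried to the line by [ln]. It is given a measure structure so that
    uniqueness of Lebesgue measure can identify it. *)
Definition log_lebesgue (B : set TR) : \bar R :=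
  (\int[lam]_(x in posln B) (x^-1)%:E)%E.

Let log_lebesgue0 : log_lebesgue set0 = 0%E.
Proof. by rewrite /log_lebesgue /posln preimage_set0 setI0 integral_set0. Qed.

Let log_lebesgue_ge0 B : (0 <= log_lebesgue B)%E.
Proof.
apply: integral_ge0 => x [/=]; rewrite in_itv/= andbT => x0 _.
by rewrite lee_fin invr_ge0 ltW.
Qed.

Let log_lebesgue_sigma_additive : semi_sigma_additive log_lebesgue.
Proof.
move=> /= F mF tF mUF; rewrite /log_lebesgue.
have -> : posln (\bigcup_n F n) = \bigcup_n posln (F n).
  by rewrite /posln preimage_bigcup setI_bigcupr.
have w0 x n : posln (F n) x -> (0 <= (x^-1)%:E)%E.
  by move=> [/=]; rewrite in_itv/= andbT lee_fin invr_ge0 => /ltW.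
apply: cvg_toP.
  apply: ereal_nondecreasing_is_cvgn => m n mn.
  by apply: lee_sum_nneg_natr => // k _ _; exact: log_lebesgue_ge0.
rewrite ge0_integral_bigcup//=.
- by move=> k; exact: measurable_posln.
- apply/measurable_EFinP; apply: measurable_funS measurable_inv_gt0 => //.
  by move=> x [n _ []].
- by move=> x [n _ /w0].
- apply/trivIsetP => i j _ _ ij; rewrite /posln setIACA setIid -preimage_setI.
  by move/trivIsetP : tF => /(_ _ _ _ _ ij) ->//; rewrite preimage_set0 setI0.
Qed.

HB.instance Definition _ := isMeasure.Build _ _ _ log_lebesgue
  log_lebesgue0 log_lebesgue_ge0 log_lebesgue_sigma_additive.

(** On []a, b]] the fundamental theorem of calculus gives [ln (expR b) - ln (expR a) = b - a]. *)
Lemma log_lebesgueE (B : set TR) : measurable B -> lam B = log_lebesgue B.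
Proof.
move=> mB; apply: lebesgue_measure_unique => //= _ [[a b]] _ <- /=.
rewrite lebesgue_measure_itv/= lte_fin /log_lebesgue.
have -> : posln `]a, b]%classic = `]expR a, expR b]%classic.
  apply/seteqP; split => x /=; rewrite /posln /= !in_itv /= ?andbT.
    by move=> [x0 /andP[ax xb]]; rewrite -[x]lnK // ltr_expR ler_expR ax xb.
  move=> /andP[ax xb]; have x0 : 0 < x by apply: lt_trans ax; exact: expR_gt0.
  by split=> //; rewrite -ltr_expR -(ler_expR (ln x)) lnK // ax.
case: ifPn => ab; last first.
  by rewrite set_itv_ge ?integral_set0// bnd_simp ltr_expR.
rewrite integral_itv_obnd_cbnd; last first.
  apply/measurable_EFinP; apply: measurable_funS measurable_inv_gt0 => //.
  move=> x /=; rewrite !in_itv/= andbT => /andP[+ _]; apply: lt_trans.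
  exact: expR_gt0.
rewrite (@continuous_FTC2 _ _ (@ln R)) ?ltr_expR //.
- by rewrite !expRK.
- apply: continuous_in_subspaceT => x; rewrite inE/= in_itv/= => /andP[ax _].
  by apply: inv_continuous; rewrite gt_eqF // (lt_le_trans _ ax) // expR_gt0.
- split.
  + move=> x; rewrite in_itv/= => /andP[ax _].
    have x0 : 0 < x by apply: lt_trans ax; exact: expR_gt0.
    by apply: ex_derive; exact: is_derive1_ln.
  + by apply: cvg_at_right_filter; apply: continuous_ln; exact: expR_gt0.
  + by apply: cvg_at_left_filter; apply: continuous_ln; exact: expR_gt0.
- move=> x; rewrite in_itv/= => /andP[ax _].
  have x0 : 0 < x by apply: lt_trans ax; exact: expR_gt0.
  by rewrite derive1E; apply: derive_val; exact: is_derive1_ln.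
Qed.

Lemma integral_inv_gt0 (E : set TR) : measurable E -> E `<=` `]0, +oo[ ->
  (\int[lam]_(x in E) (x^-1)%:E = lam ((@expR R) @^-1` E))%E.
Proof.
move=> mE E0; rewrite log_lebesgueE; last first.
  by rewrite -[X in measurable X]setTI; exact: measurable_expR.
rewrite /log_lebesgue; congr (\int[_]_(x in _) _)%E.
apply/seteqP; split => x; rewrite /posln /=.
  by move=> Ex; have /= := E0 _ Ex; rewrite in_itv/= andbT => x0; split; rewrite ?lnK.
by move=> [x0]; rewrite lnK // posrE; move: x0; rewrite in_itv /= andbT.
Qed.

End LogLebesgue.

(* An alias of [lam \x lam] that carries the sigma-finiteness needed to iterate
   Tonelli's theorem. *)
Section Lebesgue2D.
Local Open Scope classical_set_scope.
Local Open Scope ring_scope.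
Variable R : realType.
Local Notation TR := (measurableTypeR R).
Local Notation lam := (@lebesgue_measure R).
Local Open Scope ereal_scope.

Definition lebesgue2 : set (TR * TR) -> \bar R := (lam \x lam)%E.

HB.instance Definition _ := Measure.copy lebesgue2 (lam \x lam)%E.

Let lebesgue2_sigma_finite : sigma_finite setT lebesgue2.
Proof.
have /sigma_finiteP[F [TF ndF Foo]] := sigma_finiteT lam.
exists (fun n => F n `*` F n).
  rewrite -setXTT TF predeqE => -[x y]; split.
    move=> [/= [n _ Fnx] [k _ Fky]]; exists (maxn n k) => //; split.
    - by move: x Fnx; exact/subsetPset/ndF/leq_maxl.
    - by move: y Fky; exact/subsetPset/ndF/leq_maxr.
  by move=> [n _ []/= ? ?]; split; exists n.
move=> k; have [? ?] := Foo k; split; first exact: measurableX.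
rewrite [X in X < _](_ : _ = lam (F k) * lam (F k)); last exact: product_measure1E.
by rewrite lte_mul_pinfty// ge0_fin_numE.
Qed.

HB.instance Definition _ := Measure_isSigmaFinite.Build _ _ _ lebesgue2
  lebesgue2_sigma_finite.

End Lebesgue2D.

(** * Hyperbolic volume under horizontal translations and the inversion *)

Section HyperbolicVolume.
Local Open Scope classical_set_scope.
Local Open Scope ring_scope.
Variable R : realType.
Local Notation TR := (measurableTypeR R).
Local Notation T2 := (TR * TR)%type.
Local Notation T3 := (TR * TR * TR)%type.
Local Notation lam := (@lebesgue_measure R).
Local Notation lam2 := (@lebesgue2 R).
Local Notation lam3 := (lam2 \x lam)%E.

(** The extension by 0 is nonnegative and measurable on the whole line, so Tonelli's theorem applies
    to integrals over the full space. *)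
Definition inv_pos (t : R) : R := if 0 < t then t^-1 else 0.

Lemma inv_pos_ge0 t : 0 <= inv_pos t.
Proof. by rewrite /inv_pos; case: ifP => // /ltW; rewrite invr_ge0. Qed.

Lemma inv_posE t : 0 < t -> inv_pos t = t^-1.
Proof. by rewrite /inv_pos => ->. Qed.

Lemma measurable_inv_pos : measurable_fun [set: TR] inv_pos.
Proof.
have -> : inv_pos = (fun x : R => x^-1 : R) \_ (`]0, +oo[%classic : set R).
  apply/funext => t; rewrite patchE /inv_pos; congr (if _ then _ else _).
  by apply/idP/idP => [t0|]; rewrite inE /= in_itv /= andbT.
apply/(measurable_restrictT _ _).1; last exact: measurable_inv_gt0.
exact: measurable_itv.
Qed.

Lemma measurable_H3 : measurable (@H3 R : set T3).
Proof.
rewrite (_ : @H3 R = snd @^-1` `]0, +oo[%classic).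
  rewrite -[X in measurable X]setTI.
  apply: (@measurable_snd _ _ T2 TR); [exact: measurableT|exact: measurable_itv].
by apply/seteqP; split => p; rewrite /H3 /= in_itv/= andbT.
Qed.

Lemma ge0_integral2E (f : T2 -> \bar R) : measurable_fun setT f ->
  (forall q, 0 <= f q)%E ->
  (\int[lam2]_q f q = \int[lam]_x \int[lam]_y f (x, y))%E.
Proof. by move=> mf f0; exact: (@fubini_tonelli1 _ _ TR TR R lam lam f). Qed.

Lemma ge0_integral3E1 (F : T3 -> \bar R) : measurable_fun setT F ->
  (forall p, 0 <= F p)%E ->
  (\int[lam3]_p F p = \int[lam2]_q \int[lam]_t F (q, t))%E.
Proof. by move=> mF F0; exact: (@fubini_tonelli1 _ _ T2 TR R lam2 lam F). Qed.

Lemma ge0_integral3E (F : T3 -> \bar R) : measurable_fun setT F ->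
  (forall p, 0 <= F p)%E ->
  (\int[lam3]_p F p = \int[lam]_t \int[lam]_x \int[lam]_y F (x, y, t))%E.
Proof.
move=> mF F0; transitivity (\int[lam]_t \int[lam2]_q F (q, t))%E.
  exact: (@fubini_tonelli2 _ _ T2 TR R lam2 lam F).
apply: eq_integral => t _; apply: ge0_integral2E => //.
exact: measurable_fun_pair1.
Qed.

Definition hdensity (A : set T3) (p : T3) : \bar R :=
  (inv_pos p.2 ^+ 3 * \1_A p)%:E.

Lemma hdensity_ge0 A p : (0 <= hdensity A p)%E.
Proof. by rewrite lee_fin mulr_ge0 ?exprn_ge0 ?inv_pos_ge0. Qed.

Lemma measurable_hdensity A : measurable A -> measurable_fun setT (hdensity A).
Proof.
move=> mA; apply/measurable_EFinP; apply: measurable_funM.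
  apply: measurable_funX; apply: measurableT_comp => //.
  exact: measurable_inv_pos.
exact: measurable_indic.
Qed.

Lemma hvolE (A : set T3) : measurable A -> A `<=` @H3 R ->
  hvol A = (\int[lam3]_p hdensity A p)%E.
Proof.
move=> mA AH; rewrite /hvol integral_mkcond; apply: eq_integral => p _.
rewrite patchE /hdensity indicE; case: ifPn => pA; last by rewrite mulr0.
by rewrite mulr1 inv_posE ?exprVn //; apply: AH; rewrite inE in pA.
Qed.

Lemma ge0_integral2_translation (a b : R) (f : T2 -> \bar R) :
  measurable_fun setT f -> (forall q, 0 <= f q)%E ->
  (\int[lam]_x \int[lam]_y f ((x + a)%R, (y + b)%R) =
   \int[lam]_x \int[lam]_y f (x, y))%E.
Proof.
move=> mf f0; transitivity (\int[lam]_x \int[lam]_y f ((x + a)%R, y))%E.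
  apply: eq_integral => x _.
  rewrite (@ge0_integral_translation R b (fun y => f ((x + a)%R, y))) //.
  exact: measurable_fun_pair2.
rewrite (@ge0_integral_translation R a (fun x => \int[lam]_y f (x, y))%E) //.
  exact: (@measurable_fun_fubini_tonelli_F _ _ TR TR R lam f).
by move=> x; exact: integral_ge0.
Qed.

Lemma ge0_integral2_scale (a : R) (f : T2 -> \bar R) : 0 < a ->
  measurable_fun setT f -> (forall q, 0 <= f q)%E ->
  (\int[lam]_x \int[lam]_y f (x, y) =
   \int[lam]_x \int[lam]_y ((a ^+ 2)%:E * f ((a * x)%R, (a * y)%R)))%E.
Proof.
move=> a0 mf f0; have ma : measurable_fun setT (fun q : T2 => ((a * q.1)%R, q.2)).
  apply/measurable_fun_pairP; split; last exact: measurable_snd.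
  by apply: measurableT_comp (measurable_mulr a) _; exact: measurable_fst.
rewrite (@ge0_integral_scale R a (fun x => \int[lam]_y f (x, y))%E) //; last 2 first.
- exact: (@measurable_fun_fubini_tonelli_F _ _ TR TR R lam f).
- by move=> x; exact: integral_ge0.
rewrite -ge0_integralZl//; last 3 first.
- exact: (@measurable_fun_fubini_tonelli_F _ _ TR TR R lam
    (fun q => f ((a * q.1)%R, q.2)) (measurableT_comp mf ma)).
- by move=> x _; exact: integral_ge0.
- by rewrite lee_fin ltW.
apply: eq_integral => x _.
rewrite (@ge0_integral_scale R a (fun y => f ((a * x)%R, y))) //; last first.
  exact: measurable_fun_pair2.
rewrite muleA -EFinM -expr2 ge0_integralZl// ?lee_fin ?sqr_ge0//.
apply: (@measurableT_comp _ _ _ TR TR (\bar R) (fun y => f ((a * x)%R, y))).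
  exact: measurable_fun_pair2.
exact: measurable_mulr.
Qed.

Definition shift3 (a b : R) (p : T3) : T3 := (p.1.1 + a, p.1.2 + b, p.2).

Lemma measurable_shift3 a b : measurable_fun setT (shift3 a b).
Proof.
apply/measurable_fun_pairP; split; last exact: measurable_snd.
apply/measurable_fun_pairP; split => /=.
  apply: (@measurableT_comp _ _ _ T3 TR TR (fun x => x + a)); first exact: measurable_addr.
  by apply: (@measurableT_comp _ _ _ T3 T2 TR fst); exact: measurable_fst.
apply: (@measurableT_comp _ _ _ T3 TR TR (fun x => x + b)); first exact: measurable_addr.
apply: (@measurableT_comp _ _ _ T3 T2 TR snd); [exact: measurable_snd|exact: measurable_fst].
Qed.

Lemma image_shift3 a b (A : set T3) : shift3 a b @` A = shift3 (- a) (- b) @^-1` A.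
Proof.
apply/seteqP; split => [_ [[[x y] t] Ap <-]|[[x y] t] Ap]; rewrite /shift3 /=.
  by rewrite !addrK.
by exists (x - a, y - b, t) => //; rewrite /shift3 /= !subrK.
Qed.

Lemma measurable_preimage d d' (T : measurableType d) (T' : measurableType d')
    (f : T -> T') (A : set T') :
  measurable_fun setT f -> measurable A -> measurable (f @^-1` A).
Proof. by move=> mf mA; rewrite -[X in measurable X]setTI; exact: mf. Qed.

Lemma hvol_shift3 a b (A : set T3) : measurable A -> A `<=` @H3 R ->
  [/\ measurable (shift3 a b @` A), shift3 a b @` A `<=` @H3 R &
      hvol (shift3 a b @` A) = hvol A].
Proof.
move=> mA AH.
have mA' : measurable (shift3 a b @` A).
  by rewrite image_shift3; apply: measurable_preimage => //; exact: measurable_shift3.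
have AH' : shift3 a b @` A `<=` @H3 R by move=> _ [p /AH Hp <-].
split=> //; rewrite !hvolE // !ge0_integral3E; try exact: measurable_hdensity;
  try exact: hdensity_ge0.
apply: eq_integral => t _.
rewrite -[RHS](@ge0_integral2_translation (- a) (- b) (fun q => hdensity A (q, t))); last 2 first.
- exact: (measurable_fun_pair1 _ (measurable_hdensity mA)).
- by move=> q; exact: hdensity_ge0.
apply: eq_integral => x _; apply: eq_integral => y _.
by rewrite /hdensity !indicE image_shift3.
Qed.

(** The part of [A] on the ray from the origin through [(q, 1)], recorded by the logarithm of the
    height. *)
Definition exp_fiber (A : set T3) (q : T2) : set TR :=
  [set s | A (q.1 * expR s, q.2 * expR s, expR s)].

Definition cone (p : T3) : T3 := (p.1.1 * p.2, p.1.2 * p.2, p.2).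

Lemma measurable_cone : measurable_fun setT cone.
Proof.
have m11 : measurable_fun [set: T3] (fun p : T3 => p.1.1).
  by apply: (@measurableT_comp _ _ _ T3 T2 TR fst); exact: measurable_fst.
have m12 : measurable_fun [set: T3] (fun p : T3 => p.1.2).
  apply: (@measurableT_comp _ _ _ T3 T2 TR snd); [exact: measurable_snd|exact: measurable_fst].
apply/measurable_fun_pairP; split; last exact: measurable_snd.
by apply/measurable_fun_pairP; split => /=; apply: measurable_funM => //; exact: measurable_snd.
Qed.

(* In the coordinates (x / t, y / t, ln t) the hyperbolic volume is the
   Lebesgue measure. *)
Lemma hvol_exp_fiber (A : set T3) : measurable A -> A `<=` @H3 R ->
  (hvol A = \int[lam2]_q lam (exp_fiber A q))%E.
Proof.
move=> mA AH; rewrite hvolE // ge0_integral3E; last 2 first.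
- exact: measurable_hdensity.
- exact: hdensity_ge0.
(* The substitution of [(x t, y t)] for [(x, y)] contributes [t^2], which leaves [t^-1] of the
   density [t^-3]. *)
pose K (p : T3) : \bar R := (inv_pos p.2 * \1_A (cone p))%:E.
have K0 p : (0 <= K p)%E by rewrite lee_fin mulr_ge0 ?inv_pos_ge0.
have mK : measurable_fun setT K.
  apply/measurable_EFinP; apply: measurable_funM.
    by apply: (@measurableT_comp _ _ _ T3 TR R inv_pos); [exact: measurable_inv_pos|exact: measurable_snd].
  apply: (@measurableT_comp _ _ _ T3 T3 R (\1_A)); first exact: measurable_indic.
  exact: measurable_cone.
(* Integrating [K] along each ray against [dt / t] gives the Lebesgue measure of the logarithmic
   fiber. *)
transitivity (\int[lam3]_p K p)%E; last first.
  rewrite ge0_integral3E1 //; apply: eq_integral => q _.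
  pose E : set TR := (fun t => cone (q, t)) @^-1` A.
  have mE : measurable E.
    apply: measurable_preimage => //.
    by apply: measurable_fun_pair2; exact: measurable_cone.
  have E0 : E `<=` `]0, +oo[.
    by move=> t /AH; rewrite /H3 /= in_itv/= andbT.
  rewrite -[RHS]/(lam (@expR R @^-1` E)) -integral_inv_gt0 // [RHS]integral_mkcond.
  apply: eq_integral => t _; rewrite /K patchE indicE.
  case: ifPn => [tE|tE]; last first.
    rewrite (_ : (_ \in A) = false) ?mulr0//; apply/negbTE.
    by apply: contra tE; rewrite !inE.
  rewrite (_ : (_ \in A) = true) ?mulr1; last by apply/mem_set; exact: set_mem tE.
  rewrite inv_posE //; rewrite inE in tE.
  by have := E0 _ tE; rewrite /= in_itv/= andbT.
rewrite [RHS](ge0_integral3E mK K0); apply: eq_integral => t _.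
have [t0|t0] := ltP 0 t; last first.
  have w0 : inv_pos t = 0 by rewrite /inv_pos ltNge t0.
  transitivity (\int[lam]_x \int[lam]_y (0 : \bar R))%E.
    by apply: eq_integral => x _; apply: eq_integral => y _; rewrite /hdensity /= w0 expr0n mul0r.
  by apply: eq_integral => x _; apply: eq_integral => y _; rewrite /K /= w0 mul0r.
have mh : measurable_fun setT (fun q => hdensity A (q, t)).
  exact: (measurable_fun_pair1 _ (measurable_hdensity mA)).
rewrite [LHS](ge0_integral2_scale t0 mh (fun q => hdensity_ge0 A (q, t))).
apply: eq_integral => x _; apply: eq_integral => y _.
rewrite /hdensity /K /cone -EFinM /= inv_posE // !(mulrC t) mulrA; congr (_ * _)%:E.
by field; rewrite gt_eqF.
Qed.

Definition sqnorm3 (p : T3) : R := p.1.1 ^+ 2 + p.1.2 ^+ 2 + p.2 ^+ 2.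

Lemma sqnorm3_gt0 p : @H3 R p -> 0 < sqnorm3 p.
Proof.
by move=> /= p0; rewrite ltr_wpDl ?addr_ge0 ?sqr_ge0 // exprn_gt0.
Qed.

(** The inversion in the unit sphere followed by the reflection [x |-> - x], which extends
    [z |-> -1 / z]. *)
Definition inv3 (p : T3) : T3 :=
  (- p.1.1 * inv_pos (sqnorm3 p), p.1.2 * inv_pos (sqnorm3 p), p.2 * inv_pos (sqnorm3 p)).

Lemma inv3_H3 p : @H3 R p -> @H3 R (inv3 p).
Proof.
move=> Hp; have n0 := sqnorm3_gt0 Hp.
by rewrite /H3 /= mulr_gt0 // inv_posE // invr_gt0.
Qed.

Lemma inv3K p : @H3 R p -> inv3 (inv3 p) = p.
Proof.
move=> Hp; have n0 := sqnorm3_gt0 Hp.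
have nE : sqnorm3 (inv3 p) = (sqnorm3 p)^-1.
  rewrite /inv3 inv_posE // /sqnorm3 /= -/(sqnorm3 p) !exprMn sqrrN -!mulrDl.
  by rewrite -/(sqnorm3 p) expr2 mulrA divff ?mul1r ?gt_eqF.
rewrite {1}/inv3 nE [in inv_pos _]inv_posE ?invr_gt0 // invrK /inv3 inv_posE //=.
transitivity (p.1.1, p.1.2, p.2); last by case: p {Hp n0 nE} => [[]].
by move: (sqnorm3 p) n0 => r r0 /=; congr (_, _, _); field; rewrite gt_eqF.
Qed.

Lemma measurable_inv3 : measurable_fun setT inv3.
Proof.
have m11 : measurable_fun [set: T3] (fun p : T3 => p.1.1).
  by apply: (@measurableT_comp _ _ _ T3 T2 TR fst); exact: measurable_fst.
have m12 : measurable_fun [set: T3] (fun p : T3 => p.1.2).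
  apply: (@measurableT_comp _ _ _ T3 T2 TR snd); [exact: measurable_snd|exact: measurable_fst].
have m2 : measurable_fun [set: T3] (fun p : T3 => p.2) by exact: measurable_snd.
have mr : measurable_fun [set: T3] (fun p : T3 => inv_pos (sqnorm3 p)).
  apply: (@measurableT_comp _ _ _ T3 TR R inv_pos); first exact: measurable_inv_pos.
  by apply: measurable_funD; [apply: measurable_funD|]; exact: measurable_funX.
apply/measurable_fun_pairP; split => /=; last exact: measurable_funM.
apply/measurable_fun_pairP; split => /=; last exact: measurable_funM.
by apply: measurable_funM => //; exact: measurable_funN.
Qed.

Lemma image_inv3 (A : set T3) : A `<=` @H3 R ->
  inv3 @` A = @H3 R `&` inv3 @^-1` A.
Proof.
move=> AH; apply/seteqP; split => [_ [p Ap <-]|p [Hp Ap]].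
  have Hp := AH _ Ap; split; first exact: inv3_H3.
  by rewrite /= inv3K.
by exists (inv3 p) => //; exact: inv3K.
Qed.

(** The inversion maps rays from the origin to such rays. At height [expR s] the squared norm is
    [L * expR s ^+ 2], so the new height is [expR (- s) / L]: logarithms are reflected and
    translated. *)
Lemma exp_fiber_inv3 (A : set T3) (q : T2) : A `<=` @H3 R ->
  exp_fiber (inv3 @` A) q =
  (fun s => - s - ln (q.1 ^+ 2 + q.2 ^+ 2 + 1)) @^-1` exp_fiber A (- q.1, q.2).
Proof.
move=> AH; rewrite image_inv3 //; apply/seteqP.
set L := _ + 1; have L0 : 0 < L by rewrite ltr_wpDl ?addr_ge0 ?sqr_ge0.
have invE s : inv3 (q.1 * expR s, q.2 * expR s, expR s) =
    (- q.1 * expR (- s - ln L), q.2 * expR (- s - ln L), expR (- s - ln L)).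
  have es0 := expR_gt0 s.
  have nE : sqnorm3 (q.1 * expR s, q.2 * expR s, expR s) = L * expR s ^+ 2.
    by rewrite /sqnorm3 /= /L; ring.
  rewrite /inv3 nE inv_posE; last by rewrite mulr_gt0 // exprn_gt0.
  rewrite expRB lnK // expRN /=; congr (_, _, _); field; by rewrite ?gt_eqF.
split=> s; rewrite /exp_fiber /= invE; first by case.
by move=> As; split => //; exact: expR_gt0.
Qed.

Lemma measurable_exp_fiber (A : set T3) q : measurable A -> measurable (exp_fiber A q).
Proof.
move=> mA; apply: (@measurable_preimage _ _ TR T3 (fun s => (q.1 * expR s, q.2 * expR s, expR s))) => //.
apply/measurable_fun_pairP; split => /=; last exact: measurable_expR.
by apply/measurable_fun_pairP; split => /=; apply: measurable_funM => //; exact: measurable_expR.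
Qed.

Lemma measurable_lebesgue_exp_fiber (A : set T3) : measurable A ->
  measurable_fun setT (fun q => lam (exp_fiber A q)).
Proof.
move=> mA; pose e (p : T3) : T3 := (p.1.1 * expR p.2, p.1.2 * expR p.2, expR p.2).
have m11 : measurable_fun [set: T3] (fun p : T3 => p.1.1).
  by apply: (@measurableT_comp _ _ _ T3 T2 TR fst); exact: measurable_fst.
have m12 : measurable_fun [set: T3] (fun p : T3 => p.1.2).
  apply: (@measurableT_comp _ _ _ T3 T2 TR snd); [exact: measurable_snd|exact: measurable_fst].
have mexp : measurable_fun [set: T3] (fun p : T3 => expR p.2).
  by apply: (@measurableT_comp _ _ _ T3 TR R expR); [exact: measurable_expR|exact: measurable_snd].
have me : measurable_fun setT e.
  apply/measurable_fun_pairP; split => //=.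
  by apply/measurable_fun_pairP; split => /=; exact: measurable_funM.
have := @measurable_fun_xsection _ _ T2 TR R lam _ (measurable_preimage me mA).
rewrite (_ : (lam \o _) = (fun q => lam (exp_fiber A q))) //.
by apply/funext => q /=; congr (lam _); apply/seteqP; split => s; rewrite /xsection /= inE.
Qed.

Lemma ge0_integral2_opp (f : T2 -> \bar R) : measurable_fun setT f ->
  (forall q, 0 <= f q)%E ->
  (\int[lam2]_q f (- q.1, q.2)%R = \int[lam2]_q f q)%E.
Proof.
move=> mf f0; have mo : measurable_fun setT (fun q : T2 => (- q.1, q.2) : T2).
  apply/measurable_fun_pairP; split; last exact: measurable_snd.
  by apply: measurable_funN; exact: measurable_fst.
rewrite [RHS](ge0_integral2E mf f0) [LHS](ge0_integral2E (measurableT_comp mf mo)).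
  apply: (@ge0_integral_opp R (fun x => \int[lam]_y f (x, y))%E).
    exact: (@measurable_fun_fubini_tonelli_F _ _ TR TR R lam f).
  by move=> x; exact: integral_ge0.
by move=> q; exact: f0.
Qed.

(** In the ray coordinates the inversion is a reflection of the base together with an isometry of
    each line, and both preserve Lebesgue measure. *)
Lemma hvol_inv3 (A : set T3) : measurable A -> A `<=` @H3 R ->
  [/\ measurable (inv3 @` A), inv3 @` A `<=` @H3 R & hvol (inv3 @` A) = hvol A].
Proof.
move=> mA AH.
have mA' : measurable (inv3 @` A).
  rewrite image_inv3 //; apply: measurableI; first exact: measurable_H3.
  by apply: measurable_preimage => //; exact: measurable_inv3.
have AH' : inv3 @` A `<=` @H3 R by move=> _ [p /AH Hp <-]; exact: inv3_H3.
split=> //; rewrite [LHS]hvol_exp_fiber // [RHS]hvol_exp_fiber //.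
rewrite -[RHS](ge0_integral2_opp (measurable_lebesgue_exp_fiber mA)) //.
apply: eq_integral => q _; rewrite exp_fiber_inv3 //.
set L := ln _; set E := exp_fiber A _.
have mE : measurable E by exact: measurable_exp_fiber.
rewrite -[RHS](lebesgue_measure_translation (- L) mE) -[RHS]lebesgue_measureN //.
by apply: measurable_preimage mE; exact: measurable_addr.
Qed.

Lemma hvol_H3 : hvol (@H3 R) = +oo%E.
Proof.
rewrite hvol_exp_fiber //; last exact: measurable_H3.
rewrite (eq_integral (cst +oo%E)); last first.
  move=> q _ /=; rewrite (_ : exp_fiber _ _ = setT).
    by rewrite -set_itvNyy lebesgue_measure_itv.
  by apply/seteqP; split => s //= _; exact: expR_gt0.
have lamT : lam setT = +oo%E by rewrite -set_itvNyy lebesgue_measure_itv.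
rewrite integral_cst // -setXTT [X in (_ * X)%E](_ : _ = lam setT * lam setT)%E; last first.
  exact: product_measure1E.
by rewrite lamT !mulyy.
Qed.

End HyperbolicVolume.

(** * Invariance of the volume under SL(2, C) *)

Section Action.
Local Open Scope classical_set_scope.
Local Open Scope ring_scope.
Local Open Scope complex_scope.
Variable R : realType.
Local Notation TR := (measurableTypeR R).
Local Notation T3 := (TR * TR * TR)%type.
Implicit Types (M N : SL2 R) (p : R * R * R).

Lemma sqmod_ge0 (z : R[i]) : 0 <= sqmod z.
Proof. by rewrite addr_ge0 ?sqr_ge0. Qed.

Lemma sqmod_eq0 (z : R[i]) : sqmod z = 0 -> z = 0.
Proof.
case: z => x y /eqP; rewrite /sqmod /= paddr_eq0 ?sqr_ge0 // !sqrf_eq0.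
by move=> /andP[/eqP-> /eqP->].
Qed.

Lemma sqmodN (z : R[i]) : sqmod (- z) = sqmod z.
Proof. by case: z => x y; rewrite /sqmod /= !sqrrN. Qed.

(** Lagrange's identity for the vectors [(u, a t)] and [(v, c t)] of C^2. *)
Lemma sqmod_identity (a u c v : R[i]) (t : R) :
  sqmod (u * v^* + a * c^* * (t ^+ 2)%:C) + sqmod (u * c - a * v) * t ^+ 2 =
  (sqmod v + sqmod c * t ^+ 2) * (sqmod u + sqmod a * t ^+ 2).
Proof.
case: a u c v => [a1 a2] [u1 u2] [c1 c2] [v1 v2]; rewrite /sqmod /=; ring.
Qed.

Lemma act_denom_gt0 (c v : R[i]) (t : R) : 0 < t -> (c != 0) || (v != 0) ->
  0 < sqmod v + sqmod c * t ^+ 2.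
Proof.
move=> t0 cv; have t20 : 0 < t ^+ 2 by rewrite exprn_gt0.
rewrite lt_neqAle addr_ge0 ?mulr_ge0 ?sqmod_ge0 ?ltW // andbT eq_sym.
apply: contraL cv; rewrite paddr_eq0 ?mulr_ge0 ?sqmod_ge0 ?ltW //.
rewrite mulf_eq0 (gt_eqF t20) orbF => /andP[/eqP/sqmod_eq0-> /eqP/sqmod_eq0->].
by rewrite eqxx.
Qed.

Definition shear (b : R[i]) : 'M[R[i]]_2 := 1%:M + b *: delta_mx 0 1.

Lemma det_shear b : \det (shear b) == 1.
Proof. by apply/eqP; rewrite det_mx2E !mxE /=; ring. Qed.

Definition sl_shear b : SL2 R := MkSL2 (det_shear b).

Definition quarter_turn : 'M[R[i]]_2 := delta_mx 1 0 - delta_mx 0 1.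

Lemma det_quarter_turn : \det quarter_turn == 1.
Proof. by apply/eqP; rewrite det_mx2E !mxE /=; ring. Qed.

Definition sl_turn : SL2 R := MkSL2 det_quarter_turn.

Lemma shear_mulE b (A : 'M[R[i]]_2) j :
  ((shear b *m A) 0 j = A 0 j + b * A 1 j) * ((shear b *m A) 1 j = A 1 j).
Proof. by rewrite !mulmx2E !mxE /= !(mulr0, addr0, mulr1, mul1r, add0r, mul0r). Qed.

Lemma turn_mulE (A : 'M[R[i]]_2) j :
  ((quarter_turn *m A) 0 j = - A 1 j) * ((quarter_turn *m A) 1 j = A 0 j).
Proof.
by rewrite !mulmx2E !mxE /= !(mul0r, mul1r, subr0, sub0r, add0r, addr0, mulN1r).
Qed.

Definition mk_mx2 (a b c d : R[i]) : 'M[R[i]]_2 :=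
  \matrix_(i, j) (if i == 0 then (if j == 0 then a else b)
                  else (if j == 0 then c else d)).

Lemma mk_mx2_eta (A : 'M[R[i]]_2) : A = mk_mx2 (A 0 0) (A 0 1) (A 1 0) (A 1 1).
Proof. by apply: mx2P; rewrite [RHS]mxE. Qed.

Lemma sl_shear_mk b M a1 a2 a3 a4 : slval M = mk_mx2 a1 a2 a3 a4 ->
  slval (sl_shear b * M)%g = mk_mx2 (a1 + b * a3) (a2 + b * a4) a3 a4.
Proof.
move=> ME; have [s0 s1] : (forall j, (shear b *m M) 0 j = M 0 j + b * M 1 j) /\
    (forall j, (shear b *m M) 1 j = M 1 j).
  by split=> j; case: (shear_mulE b M j).
by apply: mx2P; rewrite ?[LHS]s0 ?[LHS]s1 ME !mxE.
Qed.

Lemma sl_turn_mk M a1 a2 a3 a4 : slval M = mk_mx2 a1 a2 a3 a4 ->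
  slval (sl_turn * M)%g = mk_mx2 (- a3) (- a4) a1 a2.
Proof.
move=> ME; have [s0 s1] : (forall j, (quarter_turn *m M) 0 j = - M 1 j) /\
    (forall j, (quarter_turn *m M) 1 j = M 0 j).
  by split=> j; case: (turn_mulE M j).
by apply: mx2P; rewrite ?[LHS]s0 ?[LHS]s1 ME !mxE.
Qed.

Lemma sl_one_mk : slval 1%g = mk_mx2 1 0 0 1.
Proof. by apply: mx2P; rewrite !mxE. Qed.

Lemma sl_row2_neq0 M (z : R[i]) : (M 1 0 != 0) || (M 1 0 * z + M 1 1 != 0).
Proof.
have := sl_det M; rewrite det_mx2E; have [->|//] := eqVneq (M 1 0) 0.
rewrite mul0r add0r mulr0 subr0 /=; apply: contra_eqN => /eqP ->.
by rewrite mulr0 eq_sym oner_eq0.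
Qed.

Lemma sl_row1_neq0 M (z : R[i]) : (M 0 0 != 0) || (M 0 0 * z + M 0 1 != 0).
Proof.
have := sl_det M; rewrite det_mx2E; have [->|//] := eqVneq (M 0 0) 0.
rewrite !mul0r !add0r /=; apply: contra_eqN => /eqP ->.
by rewrite mul0r oppr0 eq_sym oner_eq0.
Qed.

Lemma sl_act_shear b M p : H3 p ->
  sl_act (sl_shear b * M)%g p = shift3 (complex.Re b) (complex.Im b) (sl_act M p).
Proof.
case: p => [[x y] t] /= t0; have D0 := act_denom_gt0 t0 (sl_row2_neq0 M (x +i* y)).
rewrite /sl_act /shift3 /= !shear_mulE.
move: D0; case: (slval M 0 0) (slval M 0 1) (slval M 1 0) (slval M 1 1) b =>
  [a1 a2] [b1 b2] [c1 c2] [d1 d2] [e1 e2]; rewrite /sqmod /= => D0.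
by congr (_, _, _); field; rewrite gt_eqF.
Qed.

(** The quarter turn swaps the rows of [M] up to sign, so the denominators [D] and [D'] trade
    places. Lagrange's identity with determinant 1 gives [|w|^2 + t^2 = D D'], so the image point
    under [M] has squared norm [D' / D]. *)
Lemma sl_act_turn M p : H3 p -> sl_act (sl_turn * M)%g p = inv3 (sl_act M p).
Proof.
case: p => [[x y] t] /= t0; pose z := x +i* y.
pose a := M 0 0; pose c := M 1 0; pose u := a * z + M 0 1; pose v := c * z + M 1 1.
pose w := u * v^* + a * c^* * (t ^+ 2)%:C.
pose D := sqmod v + sqmod c * t ^+ 2; pose D' := sqmod u + sqmod a * t ^+ 2.
have D0 : 0 < D by apply: act_denom_gt0 => //; exact: sl_row2_neq0.
have D'0 : 0 < D' by apply: act_denom_gt0 => //; exact: sl_row1_neq0.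
have key : sqmod w + t ^+ 2 = D * D'.
  rewrite -sqmod_identity -/w; congr (_ + _).
  have -> : u * c - a * v = - 1.
    by rewrite -(sl_det M) det_mx2E /u /v /a /c; ring.
  by rewrite sqmodN /sqmod /= expr1n expr0n addr0 mul1r.
have wE : - v * u^* + - c * a^* * (t ^+ 2)%:C = - w^*.
  rewrite /w; case: (a) (c) (u) (v) => [a1 a2] [c1 c2] [u1 u2] [v1 v2].
  by apply/eqP; rewrite eq_complex /=; apply/andP; split; apply/eqP; ring.
have -> : sl_act M (x, y, t) = (complex.Re w / D, complex.Im w / D, t / D) by [].
have -> : sl_act (sl_turn * M)%g (x, y, t) =
    (- complex.Re w / D', complex.Im w / D', t / D').
  rewrite /sl_act /= !turn_mulE.
  rewrite -/a -/c -/z -/u -/D' mulNr -opprD -/v wE.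
  by case: w {key wE} => w1 w2 /=; rewrite opprK.
rewrite /inv3 (_ : sqnorm3 _ = D' / D); last first.
  rewrite /sqnorm3 /= !expr_div_n -!mulrDl -[X in X / _]/(sqmod w + t ^+ 2) key.
  by field; rewrite gt_eqF.
rewrite inv_posE ?divr_gt0 //=; congr (_, _, _); field; by rewrite !gt_eqF.
Qed.

(** Measurability and inclusion in [H3] are carried along so that a further generator can be applied
    to the image. *)
Definition hvol_preserving M := forall A : set T3, measurable A -> A `<=` @H3 R ->
  [/\ measurable (sl_act M @` A), sl_act M @` A `<=` @H3 R &
      hvol (sl_act M @` A) = hvol A].

Lemma sl_act1 p : H3 p -> sl_act 1%g p = p.
Proof.
case: p => [[x y] t] /= t0; rewrite /sl_act /= !mxE /= !(mul0r, mul1r, add0r, addr0).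
by rewrite /sqmod /= !(expr1n, expr0n, mul0r, addr0, mulr0, divr1, subr0, oppr0, add0r, mulr1).
Qed.

Lemma hvol_preserving1 : hvol_preserving 1%g.
Proof.
move=> A mA AH; rewrite (_ : sl_act _ @` A = A) //.
apply/seteqP; split => [_ [p Ap <-]|p Ap]; first by rewrite sl_act1 //; exact: AH.
by exists p => //; rewrite sl_act1 //; exact: AH.
Qed.

Lemma eq_image_H3 (f g h : T3 -> T3) (A : set T3) : A `<=` @H3 R ->
  (forall p, H3 p -> f p = g (h p)) -> f @` A = g @` (h @` A).
Proof.
move=> AH fgh; rewrite image_comp; apply/seteqP.
by split=> _ [p Ap <-]; exists p => //=; rewrite fgh //; exact: AH.
Qed.

Lemma hvol_preserving_shear b M : hvol_preserving M -> hvol_preserving (sl_shear b * M)%g.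
Proof.
move=> MP A mA AH; have [mMA MAH MAE] := MP A mA AH.
rewrite (eq_image_H3 AH (sl_act_shear b M)) -MAE; exact: hvol_shift3.
Qed.

Lemma hvol_preserving_turn M : hvol_preserving M -> hvol_preserving (sl_turn * M)%g.
Proof.
move=> MP A mA AH; have [mMA MAH MAE] := MP A mA AH.
rewrite (eq_image_H3 AH (sl_act_turn M)) -MAE; exact: hvol_inv3.
Qed.

(* [SL2] is generated by the shears and the quarter turn [J]: if [c != 0], then
   [(a b; c d) = T((a - 1) / c) J T(- c) J^-1 T((d - 1) / c)], and [J^-1 = J^3]. *)
Lemma sl_hvol_preserving M : hvol_preserving M.
Proof.
wlog c0 : M / M 1 0 != 0.
  move=> H; have [c0|c0] := eqVneq (M 1 0) 0; last exact: H.
  have turn4 : (sl_turn * (sl_turn * (sl_turn * (sl_turn * 1))) = 1)%g.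
    apply/val_inj; rewrite [LHS](sl_turn_mk (sl_turn_mk (sl_turn_mk (sl_turn_mk sl_one_mk)))).
    by rewrite [RHS]sl_one_mk !opprK.
  (* Here [M = J^3 (J M)], and the lower left entry of [J M] is [M 0 0], nonzero since
     [M 0 0 * M 1 1 = 1]. *)
  rewrite -[M]mul1g -turn4 -!mulgA; do 3 apply: hvol_preserving_turn.
  apply: H; rewrite mul1g (sl_turn_mk (mk_mx2_eta M)) mxE /=.
  have := sl_det M; rewrite det_mx2E c0 mulr0 subr0; apply: contra_eqN => /eqP ->.
  by rewrite mul0r eq_sym oner_eq0.
have [e eE] : exists e, e = (M 0 0 - 1) / M 1 0 by eexists.
have [f fE] : exists f, f = (M 1 1 - 1) / M 1 0 by eexists.
have [c cE] : exists c, c = - M 1 0 by eexists.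
have bE : M 0 1 = (M 0 0 * M 1 1 - 1) / M 1 0.
  by rewrite -(sl_det M) det_mx2E; field.
have -> : M = (sl_shear e * (sl_turn * (sl_shear c * (sl_turn * (sl_turn *
    (sl_turn * (sl_shear f * 1)))))))%g.
  apply/val_inj; rewrite [RHS](sl_shear_mk e (sl_turn_mk (sl_shear_mk c
    (sl_turn_mk (sl_turn_mk (sl_turn_mk (sl_shear_mk f sl_one_mk))))))).
  by rewrite [LHS]mk_mx2_eta bE eE fE cE; congr mk_mx2; field.
apply: hvol_preserving_shear; apply: hvol_preserving_turn.
apply: hvol_preserving_shear; do 3 apply: hvol_preserving_turn.
by apply: hvol_preserving_shear; exact: hvol_preserving1.
Qed.
End Action.

(** * Finite groups have infinite covolume *)

Section FiniteCovolume.
Variable R : realType.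
Local Open Scope classical_set_scope.
Local Open Scope ring_scope.
Local Notation TR := (measurableTypeR R).
Local Notation T3 := (TR * TR * TR)%type.

Lemma hvol_setU_lty (A B : set T3) : measurable A -> measurable B ->
  A `<=` @H3 R -> B `<=` @H3 R ->
  (hvol A < +oo -> hvol B < +oo -> hvol (A `|` B) < +oo)%E.
Proof.
move=> mA mB AH BH; rewrite (hvolE mA AH) (hvolE mB BH).
rewrite (@hvolE R (A `|` B)); last 2 first.
- exact: measurableU.
- by move=> p [/AH|/BH].
move=> Aoo Boo; apply: le_lt_trans (lte_add_pinfty Aoo Boo).
rewrite -ge0_integralD //; try exact: measurable_hdensity; try by move=> *; exact: hdensity_ge0.
apply: ge0_le_integral => //.
- by move=> *; exact: hdensity_ge0.
- by apply: measurable_hdensity; exact: measurableU.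
- by apply: emeasurable_funD; exact: measurable_hdensity.
- move=> p _; rewrite /hdensity -EFinD lee_fin -mulrDr ler_wpM2l ?exprn_ge0 ?inv_pos_ge0 //.
  rewrite !indicE in_setU; case: (p \in A); case: (p \in B) => /=; lra.
Qed.

(** Finitely many translates of a domain of finite volume would cover [H3], whose volume is
    infinite. *)
Lemma finite_group_infinite_covolume (Gamma : groupClosed (PSL2 R)) (s : seq (PSL2 R)) :
  (forall g, g \in Gamma -> g \in s) -> ~ finite_covolume Gamma.
Proof.
move=> Gs [D [mD DH H3E _] Doo].
have gD (g : PSL2 R) : [/\ measurable (psl_act g @` D : set T3), psl_act g @` D `<=` @H3 R &
    (hvol (psl_act g @` D) < +oo)%E].
  by have [mgD gDH ->] := sl_hvol_preserving (repr g) mD DH.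
pose U := \big[setU/set0]_(g <- s) (psl_act g @` D : set T3).
have [mU UH Uoo] : [/\ measurable U, U `<=` @H3 R & (hvol U < +oo)%E].
  rewrite /U; elim: s {Gs U} => [|g s [mU UH Uoo]].
    by rewrite big_nil; split=> //; rewrite /hvol integral_set0.
  rewrite big_cons; have [mgD gDH gDoo] := gD g; split.
  - exact: measurableU.
  - by move=> p [/gDH|/UH].
  - exact: hvol_setU_lty.
have : @H3 R = U.
  apply/seteqP; split=> // p; rewrite {1}H3E => -[g /Gs gs gDp].
  by rewrite /U -bigcup_seq; exists g.
by move=> HU; move: Uoo; rewrite -HU hvol_H3.
Qed.

End FiniteCovolume.

Lemma one_generator_abelian n k l : n = 1 -> forall u v : frac_fib n k l, commute u v.
Proof. by move=> ->; apply: fgen_commute_abelian => i j; rewrite !ord1. Qed.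

Theorem theorem4p1 (R : realType) (n k l : nat)
    (n_ge1 : (1 <= n)%N) (k_ge1 : (1 <= k)%N) (l_ge1 : (1 <= l)%N)
    (n_odd : odd n) :
  ~ hyperbolic_3orbifold_group R (frac_fib n k l).
Proof.
move=> [Gamma [_ Gamma_cov [f f_bij]]].
pose F (u : frac_fib n k l) : PSL2 R := val (f u).
have FM : {morph F : u v / (u * v)%g} by move=> u v; rewrite /F gmulfM.
have F1 : F 1%g = 1%g by apply: (@mulgI _ (F 1%g)); rewrite -FM !mulg1.
pose Fmorph : UMagmaMorphism.type (frac_fib n k l) (PSL2 R) :=
  HB.pack F (isUMagmaMorphism.Build _ _ F (F1, FM)).
have F_inj : injective Fmorph by move=> u v /val_inj; exact: bij_inj.
have cG : forall u v : frac_fib n k l, commute u v.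
  (* For [n = 1] there is a single generator; the commutator argument covers [n > 1]. *)
  have [n1|n_neq1] := eqVneq n 1; first exact: one_generator_abelian.
  by apply: (rep_inj_abelian F_inj) => //; rewrite ltn_neqAle eq_sym n_neq1.
have [s sG] := abelian_frac_fib_finite k_ge1 cG.
have Gs g : g \in Gamma -> g \in map F s.
  move=> gG; have [f' _ f'K] := f_bij; apply/mapP; exists (f' (Sub g gG)) => //.
  by rewrite /F f'K SubK.
exact: finite_group_infinite_covolume Gs Gamma_cov.
Qed.
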